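(* Let $S_d$ be the dyadic square function on $\mathbb{R}^n$, $$S_df(x)=\left(\sum_{Q\in\Delta}(f_Q-f_{\widehat{Q}})^2\chi_Q(x)\right)^{1/2},$$ fix $1<p<\infty$, and let $(u,v)$ be a pair of weights on $\mathbb{R}^n$. (1) Suppose $1<p\le 2$ and $B$ is a Young function such that $\bar{B}\in B_p$. If $$\sup_Q\|u^{1/p}\|_{p,Q}\,\|v^{-1/p}\|_{B,Q}<\infty,$$ then there is a constant $C$, independent of $f$, such that $\|S_df\|_{L^p(u)}\le C\|f\|_{L^p(v)}$ for every locally integrable $f$. (2) Suppose $2<p<\infty$ and $A$ and $B$ are Young functions such that $\bar{A}\in B_{(p/2)'}$ and $\bar{B}\in B_p$. If $$\sup_Q\|u^{2/p}\|_{A,Q}^{1/2}\,\|v^{-1/p}\|_{B,Q}<\infty,$$ then there is a constant $C$, independent of $f$, such that $\|S_df\|_{L^p(u)}\le C\|f\|_{L^p(v)}$ for every locally integrable $f$. In both parts the suprema are over all cubes $Q\subset\mathbb{R}^n$.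
   Context: $\Delta$ is the collection of dyadic cubes in $\mathbb{R}^n$. For $Q\in\Delta$, $\widehat{Q}$ is its dyadic parent: the unique dyadic cube containing $Q$ whose side-length is twice that of $Q$. $f_Q=\frac{1}{|Q|}\int_Q f\,dx$. A weight is a non-negative, locally integrable function on $\mathbb{R}^n$; $\|f\|_{L^p(w)}=\left(\int|f|^pw\,dx\right)^{1/p}$; for $1<r<\infty$, $r'=r/(r-1)$; cubes have sides parallel to the axes. A Young function is a function $A:[0,\infty)\to[0,\infty)$ that is continuous, convex and strictly increasing, with $A(0)=0$ and $A(t)/t\to\infty$ as $t\to\infty$. Its associate function is $\bar{A}(t)=\sup_{s>0}\{st-A(s)\}$. The localized Luxemburg norm on a cube $Q$ is $$\|f\|_{A,Q}=\inf\left\{\lambda>0:\frac{1}{|Q|}\int_Q A\left(\frac{|f(x)|}{\lambda}\right)dx\le 1\right\},$$ and $\|f\|_{p,Q}=\left(\frac{1}{|Q|}\int_Q|f|^p\,dx\right)^{1/p}$. A Young function $A$ satisfies the $B_r$ condition, written $A\in B_r$, if for some $c>0$, $\int_c^\infty \frac{A(t)}{t^r}\frac{dt}{t}<\infty$. *)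

(* Defs.v *)
From HB Require Import structures.
From mathcomp Require Import all_boot all_order all_algebra.
From mathcomp Require Import all_classical all_reals all_analysis.
From mathcomp Require Import zify ring lra.

Set Implicit Arguments.
Unset Strict Implicit.
Unset Printing Implicit Defensive.

Import Order.TTheory GRing.Theory Num.Theory.
Import numFieldNormedType.Exports.

Local Open Scope classical_set_scope.
Local Open Scope ring_scope.

(** Lebesgue measure on R^d, for d = n.+1 >= 1, on row vectors: the outer
    measure by countable covers with half-open boxes, restricted to its
    Caratheodory sigma-algebra (hence complete). *)
Section lebesgue_Rn.
Context {R : realType} {n : nat}.
Local Notation V := 'rV[R]_n.+1.

Definition box (a b : V) : set V :=
  [set x | forall i, a ord0 i <= x ord0 i < b ord0 i].

Definition box_volume (a b : V) : R :=
  \prod_i Num.max 0 (b ord0 i - a ord0 i).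

Definition box_cover (X : set V) : set (nat -> V * V) :=
  [set ab | X `<=` \bigcup_k box (ab k).1 (ab k).2].

Definition lebesgue_outer (X : set V) : \bar R :=
  ereal_inf [set (\sum_(0 <= k <oo) (box_volume (ab k).1 (ab k).2)%:E)%E
            | ab in box_cover X].

Lemma box_volume_ge0 a b : 0 <= box_volume a b.
Proof. by apply: prodr_ge0 => i _; rewrite le_max lexx. Qed.

Lemma lebesgue_outer_ge0 X : (0 <= lebesgue_outer X)%E.
Proof.
apply: le_ereal_inf_tmp => _ [ab _ <-].
by apply: nneseries_ge0 => k _ _; rewrite lee_fin box_volume_ge0.
Qed.

Lemma lebesgue_outer0 : lebesgue_outer set0 = 0%E.
Proof.
apply/eqP; rewrite eq_le lebesgue_outer_ge0 andbT.
apply: ereal_inf_lbound; exists (fun=> (0, 0)); first exact: sub0set.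
apply: eseries0 => k _ _; congr EFin; rewrite /box_volume /=.
by rewrite big_ord_recl subrr maxxx mul0r.
Qed.

Lemma le_lebesgue_outer : {homo lebesgue_outer : A B / A `<=` B >-> (A <= B)%E}.
Proof.
move=> A B AB; apply/ereal_inf_le_tmp => _ [ab Bab <-].
by exists ab => //; exact: subset_trans AB Bab.
Qed.

Lemma lebesgue_outer_sigma_subadditive : sigma_subadditive lebesgue_outer.
Proof.
move=> A; have [[i ioo]|] := pselect (exists i, lebesgue_outer (A i) = +oo%E).
  rewrite (eseries_pinfty _ _ ioo) ?leey// => k _.
  by rewrite -ltNye (lt_le_trans _ (lebesgue_outer_ge0 _)).
rewrite -forallNE => Aoo.
apply/lee_addgt0Pr => e e0.
rewrite (le_trans _ (epsilon_trick _ _ (ltW e0)))//; last first.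
  by move=> k; exact: lebesgue_outer_ge0.
pose vol (ab : V * V) := (box_volume ab.1 ab.2)%:E.
have vol0 ab : (0 <= vol ab)%E by rewrite lee_fin box_volume_ge0.
pose P k ab := box_cover (A k) ab /\
  (\sum_(0 <= j <oo) vol (ab j) <=
     lebesgue_outer (A k) + (e / (2 ^ k.+1)%:R)%:E)%E.
have [G PG] : {G : nat -> nat -> V * V & forall k, P k (G k)}.
  apply: (@choice _ _ P) => k.
  have ek : 0 < e / (2 ^ k.+1)%:R by rewrite divr_gt0// ltr0n expn_gt0.
  have fk : lebesgue_outer (A k) \is a fin_num.
    by rewrite ge0_fin_numE ?lebesgue_outer_ge0// ltey; apply/eqP/Aoo.
  have [_ [ab Aab <-] le_ab] := lb_ereal_inf_adherent ek fk.
  by exists ab; split => //; exact: ltW.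
apply: (@le_trans _ _ (\esum_(i in setT) vol (G i.1 i.2))%E).
  apply: ereal_inf_lbound.
  have /card_esym/ppcard_eqP[f] := card_nat2.
  exists (fun k => G (f k).1 (f k).2).
    move=> t [i _ /(PG i).1[j _ ?]].
    by exists (f^-1%FUN (i, j)) => //; rewrite invK// inE.
  rewrite nneseries_esumT => [|k]; last exact: vol0.
  by rewrite [RHS](reindex_esum setT setT f).
rewrite (_ : esum _ _ =
    (\sum_(0 <= i <oo) \sum_(0 <= j <oo) vol (G i j))%E); last first.
  rewrite nneseries_esumT => [|k]; last exact: nneseries_ge0.
  under [RHS]eq_esum do rewrite nneseries_esumT//.
  rewrite esum_esum => [|? ? _ _]; last exact: vol0.
  by apply: congr2 => //; apply/seteqP; split.
apply: lee_nneseries => k _; first by move=> _; exact: nneseries_ge0.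
exact: (PG k).2.
Qed.

HB.instance Definition _ := isOuterMeasure.Build R V lebesgue_outer
  lebesgue_outer0 lebesgue_outer_ge0 le_lebesgue_outer
  lebesgue_outer_sigma_subadditive.

End lebesgue_Rn.
Arguments lebesgue_outer R n : clear implicits.

Notation Rn R n := (caratheodory_type (lebesgue_outer R n)).

Definition lebesgueRn (R : realType) (n : nat) : set (Rn R n) -> \bar R :=
  lebesgue_outer R n.

HB.instance Definition _ (R : realType) (n : nat) :=
  isMeasure.Build _ (Rn R n) R (@lebesgueRn R n)
    (@caratheodory_measure0 _ _ (lebesgue_outer R n))
    (@caratheodory_measure_ge0 _ _ (lebesgue_outer R n))
    (@caratheodory_measure_sigma_additive _ _ (lebesgue_outer R n)).

Section norms.
Context {R : realType} {n : nat}.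
Local Notation V := (Rn R n).
Local Notation mu := (@lebesgueRn R n).

(** Cubes are taken half-open, so that dyadic cubes are cubes; faces are
    Lebesgue-null, so this does not affect any average or norm. *)
Definition cube (a : 'rV[R]_n.+1) (l : R) : set V :=
  [set x : 'rV[R]_n.+1 | forall i, a ord0 i <= x ord0 i < a ord0 i + l].

Definition cubes : set (set V) :=
  [set Q | exists a, exists2 l, 0 < l & Q = cube a l].

Definition locally_integrable_Rn (f : V -> R) : Prop :=
  measurable_fun setT f /\
  forall K : set 'rV[R]_n.+1, compact K -> mu.-integrable (K : set V) (EFin \o f).

Definition weight (w : V -> R) : Prop :=
  (forall x, 0 <= w x) /\ locally_integrable_Rn w.

Definition eaverage (Q : set V) (f : V -> \bar R) : \bar R :=
  (((fine (mu Q))^-1)%:E * \int[mu]_(x in Q) f x)%E.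

Definition average (Q : set V) (f : V -> R) : R :=
  (fine (mu Q))^-1 * \int[mu]_(x in Q) f x.

(** [w ^ r], with value [+oo] where [w] vanishes and [r < 0] (whereas
    [0 `^ r = 0] in the library for such [r]). *)
Definition epow (w : V -> R) (r : R) : V -> \bar R := fun x =>
  if (w x == 0) && (r < 0) then +oo%E else (w x `^ r)%:E.

Definition normQ (p : R) (Q : set V) (f : V -> \bar R) : \bar R :=
  poweR (eaverage Q (fun x => poweR `|f x| p)) p^-1.

Definition weighted_norm (p : R) (w : V -> R) (f : V -> \bar R) : \bar R :=
  poweR (\int[mu]_x (poweR `|f x| p * (w x)%:E))%E p^-1.

End norms.
Arguments cubes R n : clear implicits.

Section young.
Context {R : realType}.

(** Only the values of [A] on [[0, +oo[] are relevant. *)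
Record young_function (A : R -> R) : Prop := YoungFunction {
  young_ge0 : forall t : R, 0 <= t -> 0 <= A t ;
  young_continuous : {within [set` `[0, +oo[], continuous A} ;
  young_convex : @convex_function R R^o [set` `[0, +oo[] A ;
  young_increasing : {in `[0, +oo[ &, {homo A : s t / s < t}} ;
  young0 : A 0 = 0 ;
  young_superlinear : A t / t @[t --> +oo] --> +oo
}.

Definition young_associate (A : R -> R) : R -> R := fun t =>
  sup [set s * t - A s | s in [set` `]0, +oo[]].

Definition Bcond (r : R) (A : R -> R) : Prop :=
  exists2 c : R, 0 < c &
    (\int[lebesgue_measure]_(t in [set` `[c, +oo[])
       (A t / t `^ r / t)%:E < +oo)%E.

Definition conj_exponent (r : R) : R := r / (r - 1).

Definition young_ext (A : R -> R) (y : \bar R) : \bar R :=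
  if y is r%:E then (A r)%:E else +oo%E.

Definition luxemburg (n : nat) (A : R -> R) (Q : set (Rn R n))
    (f : Rn R n -> \bar R) : \bar R :=
  ereal_inf [set l%:E | l in [set l : R | 0 < l /\
    (eaverage Q (fun x => young_ext A (`|f x| * l^-1%:E)) <= 1)%E]].

End young.

Section dyadic.
Context {R : realType} {n : nat}.
Local Notation V := (Rn R n).

(** [(k, m)] indexes the cube of side-length [2^k] with corner [2^k m]. *)
Definition dyadic_index : Type := (int * 'rV[int]_n.+1)%type.

Definition dyadic_side (q : dyadic_index) : R := 2 ^ q.1.

Definition dyadic_cube (q : dyadic_index) : set V :=
  cube (\row_i (dyadic_side q * (q.2 ord0 i)%:~R)) (dyadic_side q).

(** [divz] rounds down, also on negative integers; [dyadic_parentP] and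
    [dyadic_cube_inj] below check this indexing against the description of
    the parent as a set. *)
Definition dyadic_parent (q : dyadic_index) : dyadic_index :=
  (q.1 + 1, \row_i (q.2 ord0 i %/ 2)%Z).

Lemma dyadic_side_gt0 q : 0 < dyadic_side q.
Proof. by rewrite exprz_gt0. Qed.

Lemma dyadic_sideS q : dyadic_side (dyadic_parent q) = 2 * dyadic_side q.
Proof. by rewrite /dyadic_side /= exprzDr ?unitfE// expr1z mulrC. Qed.

Lemma dyadic_side_inj q q' : dyadic_side q = dyadic_side q' -> q.1 = q'.1.
Proof. by apply: ieexprIz => //; rewrite ?pnatr_eq1. Qed.

Lemma cubeP (a : 'rV[R]_n.+1) (l : R) (x : 'rV[R]_n.+1) :
  cube a l x <-> forall i, a ord0 i <= x ord0 i < a ord0 i + l.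
Proof. by []. Qed.

Lemma cube_inj (a a' : 'rV[R]_n.+1) (l l' : R) : 0 < l -> 0 < l' ->
  cube a l = cube a' l' -> a = a' /\ l = l'.
Proof.
move=> l0 l'0 E.
have in_corner (b : 'rV[R]_n.+1) (r : R) : 0 < r -> cube b r b.
  by move=> r0; apply/cubeP => i; rewrite lexx ltrDl.
have aa' : a = a'.
  apply/rowP => i; apply/eqP; rewrite eq_le.
  have := in_corner a' l' l'0; rewrite -E => /cubeP/(_ i)/andP[-> _] /=.
  by have := in_corner a l l0; rewrite E => /cubeP/(_ i)/andP[-> _].
split=> //; subst a'.
have far r s : 0 < r -> 0 < s -> cube a r = cube a s -> r <= s.
  move=> r0 s0 Ers; rewrite leNgt; apply/negP => sr.
  have : cube a r (\row_i (a ord0 i + s)).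
    by apply/cubeP => i; rewrite mxE lerDl (ltW s0) ltrD2l.
  by rewrite Ers => /cubeP/(_ ord0); rewrite mxE ltxx andbF.
by apply/eqP; rewrite eq_le !far.
Qed.

Lemma dyadic_cube_inj : injective dyadic_cube.
Proof.
move=> [k m] [k' m'] /cube_inj[||/rowP mm' /dyadic_side_inj/= kk'].
- exact: dyadic_side_gt0.
- exact: dyadic_side_gt0.
rewrite -{k'}kk' in mm' *; congr (_, _); apply/rowP => i.
have := mm' i; rewrite !mxE => /mulfI; rewrite gt_eqF ?dyadic_side_gt0//.
by move=> /(_ isT) /eqP; rewrite eqr_int => /eqP.
Qed.

Lemma divz2P (a b : int) : (b * 2 <= a < b * 2 + 2) <-> b = (a %/ 2)%Z.
Proof. lia. Qed.

Lemma dyadic_parentP (q q' : dyadic_index) :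
  dyadic_cube q `<=` dyadic_cube q' /\ dyadic_side q' = 2 * dyadic_side q <->
  q' = dyadic_parent q.
Proof.
have s0 := dyadic_side_gt0 q.
have bounds (b a : int) : b * 2 <= a < b * 2 + 2 <->
    2 * dyadic_side q * b%:~R <= dyadic_side q * a%:~R
      < 2 * dyadic_side q * b%:~R + 2 * dyadic_side q.
  have -> : 2 * dyadic_side q * b%:~R = dyadic_side q * (b * 2)%:~R.
    by rewrite intrM; ring.
  have -> : dyadic_side q * (b * 2)%:~R + 2 * dyadic_side q =
            dyadic_side q * (b * 2 + 2)%:~R.
    by rewrite intrD; ring.
  by rewrite ler_pM2l// ltr_pM2l// ler_int ltr_int.
split=> [[sub side]|->].
  case: q' sub side => k m sub side.
  have ek : k = q.1 + 1 by apply: (@dyadic_side_inj (k, m)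
    (dyadic_parent q)); rewrite dyadic_sideS.
  rewrite /dyadic_parent -ek; congr (_, _); apply/rowP => i; rewrite mxE.
  apply/divz2P/bounds; rewrite -side.
  have /sub/cubeP/(_ i) : dyadic_cube q
      (\row_j (dyadic_side q * (q.2 ord0 j)%:~R) : 'rV_n.+1).
    by apply/cubeP => j; rewrite !mxE lexx ltrDl.
  by rewrite !mxE.
split; last exact: dyadic_sideS.
move=> x /cubeP qx; apply/cubeP => i; have := qx i.
rewrite !mxE dyadic_sideS => /andP[lex ltx].
have /divz2P : (q.2 ord0 i %/ 2)%Z = (q.2 ord0 i %/ 2)%Z by [].
set b := (_ %/ 2)%Z => /andP[le1 lt1].
have : (q.2 ord0 i + 1)%:~R <= (b * 2 + 2)%:~R :> R.
  by rewrite ler_int; lia.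
have : (b * 2)%:~R <= (q.2 ord0 i)%:~R :> R by rewrite ler_int.
rewrite !intrD intrM => h1 h2; apply/andP; split.
  apply: le_trans lex; rewrite (mulrC 2) -mulrA ler_pM2l// mulrC//.
apply: lt_le_trans ltx _.
rewrite -[X in _ + X]mulr1 -mulrDr (_ : _ + 2 * _ =
  dyadic_side q * (b%:~R * 2 + 2)); last by ring.
by rewrite ler_pM2l.
Qed.

Definition square_function (f : V -> R) : V -> \bar R := fun x =>
  poweR (\esum_(q in [set: dyadic_index])
    ((average (dyadic_cube q) f - average (dyadic_cube (dyadic_parent q)) f) ^+ 2
       * \1_(dyadic_cube q) x)%:E) 2^-1.

End dyadic.

(* Main.v *)
Require Import Defs.
From mathcomp Require Import all_boot all_order all_algebra.
From mathcomp Require Import all_classical all_reals all_analysis measurable_realfun.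
From mathcomp Require Import zify ring lra.
Set Implicit Arguments.
Unset Strict Implicit.
Unset Printing Implicit Defensive.

Import Order.TTheory GRing.Theory Num.Theory.
Import numFieldNormedType.Exports.

Local Open Scope classical_set_scope.
Local Open Scope ring_scope.

(** The sum of squares that defines the square function S f is compared with a
    sum over a sparse family of cubes, and the bump conditions are then used on
    each cube of this family.

    Sparse domination. Fix a cube. Going down from it, stop at a cube Q as soon
    as the average of |f| over Q exceeds 4 times its value at the last stop, or
    the sum of the squares (f_Q - f_Q^)^2 accumulated since the last stop exceeds
    a large multiple K of the square of that value. By construction the sum of all
    the squares along a chain of cubes is at most a constant times the sum of
    (|f|_Q)^2 over the stopping cubes Q of the chain ([pointwise_domination]). The
    stopping cubes inside a stopping cube Q have total volume at most 2 |Q|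
    ([carleson]): the first rule selects little volume since it is a maximal
    function estimate, and the second one since the square function of a bounded
    martingale is bounded in L^2. Both facts are contained in one potential that
    is a martingale.

    Carleson embedding. Let Phi satisfy B_r and let a_Q >= 0 be numbers such that
    the average of Phi(g / l) over Q is at least 1 whenever 0 < l <= a_Q; this says
    that a_Q is at most the Luxemburg norm of g. Then the sum of a_Q^r |Q| over the
    stopping cubes is at most C times the integral of g^r ([carleson_embedding]).
    For each l = 2^j the stopping cubes with e a_Q >= l, where e is a small
    constant, have total volume at most 4 times the integral of Phi(g / l) over the
    set where g > c l, and the B_r integral of Phi controls the sum over j of 2^(jr)
    times these integrals.

    Conclusion. Let b_Q be, up to a factor, the norm of v^(-1/p) on Q. Young's
    inequality shows that a_Q = |f|_Q / (2 b_Q) is as above for g = |f| v^(1/p)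
    and the associate of B ([volume_le_integral]). If p <= 2, then (S f)^p is at
    most a constant times the sum of (|f|_Q)^p over the stopping cubes, the bump
    condition bounds (|f|_Q)^p u(Q) by a constant times a_Q^p |Q|, and the
    embedding with r = p concludes. If p > 2, let H be the sparse sum, s = p / 2
    and h = H^(s - 1). The integral X of H^s u is the sum of (|f|_Q)^2 (h u)(Q),
    which is at most a constant times the sum of a_Q^2 a'_Q |Q|, where a'_Q is
    the analogue of a_Q for h u and the norm of u^(2/p). Young's inequality and
    the embedding with exponents p and s' bound X by a multiple of the integral of
    |f|^p v plus X / 2, and X is finite.

    This is done inside each cube of level k for finitely many generations, with
    constants that do not depend on these; summing over the cubes of level k and
    letting both the level and the number of generations go to infinity gives the
    theorem ([local_to_global]). *)

(** * Lebesgue measure of cubes *)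

Section lebesgue_cubes.
Context {R : realType} {n : nat}.
Local Notation V := 'rV[R]_n.+1.
Local Notation outer := (lebesgue_outer R n).
Local Notation mu := (@lebesgueRn R n).

Definition set_coord (x : V) (i : 'I_n.+1) (c : R) : V :=
  \row_j (if j == i then c else x ord0 j).

Lemma box_volume_split (a b : V) i c :
  box_volume a b = box_volume a (set_coord b i (Num.min (b ord0 i) c)) +
                   box_volume (set_coord a i (Num.max (a ord0 i) c)) b.
Proof.
rewrite /box_volume !(bigD1 (P := xpredT) i)//=.
rewrite !mxE eqxx.
have e1 : \prod_(j < n.+1 | j != i)
   Num.max 0 (set_coord b i (Num.min (b ord0 i) c) ord0 j - a ord0 j)
   = \prod_(j < n.+1 | j != i) Num.max 0 (b ord0 j - a ord0 j).
  by apply: eq_bigr => j /negbTE ji; rewrite mxE ji.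
have e2 : \prod_(j < n.+1 | j != i)
   Num.max 0 (b ord0 j - set_coord a i (Num.max (a ord0 i) c) ord0 j)
   = \prod_(j < n.+1 | j != i) Num.max 0 (b ord0 j - a ord0 j).
  by apply: eq_bigr => j /negbTE ji; rewrite mxE ji.
rewrite e1 e2 -mulrDl; congr (_ * _).
set u := a ord0 i; set w := b ord0 i.
by case: (leP w c) => wc; case: (leP u c) => uc; rewrite ?maxEle ?minEle;
  repeat case: ifPn => ?; lra.
Qed.

(** A hyperplane cuts every box of a cover into two boxes whose volumes add up. *)
Lemma measurable_halfspace (i : 'I_n.+1) (c : R) :
  measurable ([set x : V | x ord0 i < c] : set (Rn R n)).
Proof.
apply: le_caratheodory_measurable => X.
apply: le_ereal_inf_tmp => _ [ab Xab <-].
pose lo k := ((ab k).1, set_coord (ab k).2 i (Num.min ((ab k).2 ord0 i) c)).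
pose hi k := (set_coord (ab k).1 i (Num.max ((ab k).1 ord0 i) c), (ab k).2).
have vol0 (ab' : nat -> V * V) k :
    (0 <= (box_volume (ab' k).1 (ab' k).2)%:E)%E.
  by rewrite lee_fin box_volume_ge0.
rewrite (eq_eseriesr (g := fun k => ((box_volume (lo k).1 (lo k).2)%:E +
    (box_volume (hi k).1 (hi k).2)%:E)%E)); last first.
  by move=> k _; rewrite -EFinD -box_volume_split.
rewrite nneseriesD//.
apply: leeD.
- apply: ereal_inf_lbound; exists lo => //= x [/Xab[k _ xk] /= xc].
  exists k => //= j; rewrite mxE; case: eqP => [->|_]; last exact: xk.
  by have /andP[-> xb] := xk i; rewrite lt_min xb.
- apply: ereal_inf_lbound; exists hi => //= x [/Xab[k _ xk] /= /negP].
  rewrite -leNgt => cx.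
  exists k => //= j; rewrite mxE; case: eqP => [->|_]; last exact: xk.
  by have /andP[ax ->] := xk i; rewrite ge_max ax cx.
Qed.

Lemma measurable_cube (a : V) (l : R) : measurable (cube a l).
Proof.
rewrite (_ : cube a l = \bigcap_(i in [set: 'I_n.+1])
   ([set x : V | x ord0 i < a ord0 i + l] `\` [set x : V | x ord0 i < a ord0 i]
     : set (Rn R n))).
  apply: fin_bigcap_measurable => // i _.
  by apply: measurableD; exact: measurable_halfspace.
apply/seteqP; split=> x /= xQ.
  by move=> i _; have /andP[h1 h2] := xQ i; split => //=; apply/negP; rewrite -leNgt.
by move=> i; have [//|/= -> /negP] := xQ i; rewrite -leNgt => ->.
Qed.

Lemma lebesgue_outer_shift_le (X : set V) (t : V) :
  (outer [set (x + t)%R | x in X] <= outer X)%E.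
Proof.
apply: ereal_inf_le_tmp => _ [ab Xab <-].
exists (fun k => ((ab k).1 + t, (ab k).2 + t)).
  move=> _ [x /Xab[k _ xk] <-]; exists k => //= i.
  by have := xk i; rewrite !mxE lerD2r ltrD2r.
apply: eq_eseriesr => k _; congr EFin; apply: eq_bigr => i _ /=.
by rewrite !mxE opprD addrACA subrr addr0.
Qed.

Lemma cube_shift (a t : V) (l : R) :
  cube (a + t) l = [set x + t | x in (cube a l : set V)].
Proof.
apply/seteqP; split => [x xQ|_ [x xQ <-] i].
  exists (x - t); last by rewrite subrK.
  move=> i; have := xQ i; rewrite !mxE => /andP[h1 h2].
  by rewrite lerBrDr h1 ltrBlDr addrAC.
by have := xQ i; rewrite !mxE addrAC lerD2r ltrD2r.
Qed.

(** The outer measure is invariant under translations since the volume of boxes is.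
    The children of a dyadic cube, being translates of each other, therefore share
    its measure equally. *)
Lemma measure_cube_translate (a b : V) (l : R) : mu (cube a l) = mu (cube b l).
Proof.
have le (c d : V) : (mu (cube d l) <= mu (cube c l))%E.
  by rewrite -[d](subrKC c) cube_shift; exact: lebesgue_outer_shift_le.
by apply/eqP; rewrite eq_le !le.
Qed.

Lemma measure_cube_lty (a : V) (l : R) : (mu (cube a l) < +oo)%E.
Proof.
apply: (@le_lt_trans _ _ (box_volume a (\row_i (a ord0 i + l)))%:E); last exact: ltry.
apply: ereal_inf_lbound.
exists (fun k => if k == 0%N then (a, \row_i (a ord0 i + l)) else (0, 0) : V * V).
  by move=> x xQ; exists 0%N => //= i; rewrite mxE; exact: xQ.
rewrite (nneseries_recl)//; last by move=> k _; rewrite lee_fin box_volume_ge0.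
rewrite [X in (_ + X)%E]eseries0 ?adde0//= => k k0 _; congr EFin.
by case: k k0 => //= k _; rewrite /box_volume big_ord_recl subrr maxxx mul0r.
Qed.

Lemma locally_integrable_cube (f : Rn R n -> R) (a : V) (l : R) :
  locally_integrable_Rn f -> mu.-integrable (cube a l) (EFin \o f).
Proof.
move=> [mf intf].
pose K : set V := [set x | forall i, `[a ord0 i, a ord0 i + l]%classic (x ord0 i)].
have cK : compact K.
  by apply: (@rV_compact R n.+1 (fun i => `[a ord0 i, a ord0 i + l]%classic)) => i;
    exact: segment_compact.
have mK : measurable (K : set (Rn R n)).
  rewrite (_ : K = \bigcap_(i in [set: 'I_n.+1])
     \bigcap_(k in [set: nat]) ([set x : V | x ord0 i < a ord0 i + l + k.+1%:R^-1] `\`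
      [set x : V | x ord0 i < a ord0 i] : set (Rn R n))).
    apply: fin_bigcap_measurable => // i _.
    apply: bigcap_measurable; first by exists 0%N.
    by move=> k _; apply: measurableD; exact: measurable_halfspace.
  apply/seteqP; split=> x /= xQ.
    move=> i _ k _; have /= := xQ i; rewrite in_itv/= => /andP[h1 h2]; split => /=.
      by rewrite (le_lt_trans h2)// ltrDl.
    by apply/negP; rewrite -leNgt.
  move=> i; rewrite /= in_itv/=; apply/andP; split.
    by have [//|_ /negP] := xQ i Logic.I 0%N; rewrite -leNgt.
  apply/ler_addgt0Pr => e e0.
  have [k ke] := ltr_add_invr (ltr_pwDr e0 (lexx (a ord0 i + l))).
  have [//|/= h _] := xQ i Logic.I k.
  by apply/ltW/(lt_trans h).
apply: integrableS (intf _ cK) => //; first exact: measurable_cube.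
move=> x xQ i; rewrite /= in_itv/=.
by have /andP[-> /ltW ->] := xQ i.
Qed.

End lebesgue_cubes.

(** * Dyadic cubes and averages *)

Section dyadic_geometry.
Context {R : realType} {n : nat}.
Local Notation V := (Rn R n).
Local Notation mu := (@lebesgueRn R n).
Local Notation index := (@dyadic_index n).
Local Notation E := {ffun 'I_n.+1 -> bool}.
Local Notation Q := (@dyadic_cube R n).

Definition dyadic_child (q : index) (e : E) : index :=
  (q.1 - 1, \row_i (q.2 ord0 i * 2 + (e i)%:Z)).

Lemma dyadic_childK q e : dyadic_parent (dyadic_child q e) = q.
Proof.
case: q => k m; rewrite /dyadic_parent /dyadic_child /= subrK; congr (_, _).
have half (z : int) (b : bool) : ((z * 2 + b%:Z) %/ 2)%Z = z by case: b; lia.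
by apply/rowP => i; rewrite !mxE half.
Qed.

Lemma dyadic_child_inj q : injective (dyadic_child q).
Proof.
move=> e e' [/rowP ee]; apply/ffunP => i.
by have := ee i; rewrite !mxE => /addrI; case: (e i) (e' i) => [] [].
Qed.

Lemma dyadic_parent_eq q r : dyadic_parent r = q -> exists e, r = dyadic_child q e.
Proof.
move=> <-; exists [ffun i => (r.2 ord0 i %% 2)%Z == 1].
case: r => k m; rewrite /dyadic_child/= addrK; congr (_, _).
have half (z : int) : z = (z %/ 2)%Z * 2 + ((z %% 2)%Z == 1 : bool)%:Z.
  by case: eqP; lia.
by apply/rowP => i; rewrite !mxE ffunE -half.
Qed.

Definition dyadic_cell (k : int) (x : V) : index :=
  (k, \row_i Num.floor ((x : 'rV[R]_n.+1) ord0 i / 2 ^ k)).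

Lemma dyadic_cubeE q x : Q q x <-> q = dyadic_cell q.1 x.
Proof.
have s0 := @dyadic_side_gt0 R n q.
have key (t : R) (m : int) : (@dyadic_side R n q * m%:~R <= t <
    @dyadic_side R n q * m%:~R + @dyadic_side R n q) <-> m = Num.floor (t / 2 ^ q.1).
  rewrite -/(@dyadic_side R n q).
  rewrite -{3}[@dyadic_side R n q]mulr1 -mulrDr.
  rewrite mulrC -ler_pdivlMr// mulrC -ltr_pdivrMl// [_^-1 * t]mulrC.
  by split=> [h|->]; [rewrite (floor_def (m := m))// intrD|rewrite -intrD1 floor_itv].
case: q key s0 => k m key s0; split => [xQ|[]/rowP mE i].
  by congr (_, _); apply/rowP => i; rewrite mxE; apply/key; have := xQ i; rewrite !mxE.
by rewrite mxE; apply/key; rewrite /= mE mxE.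
Qed.

Lemma mem_dyadic_cell k x : Q (dyadic_cell k x) x.
Proof. exact/dyadic_cubeE. Qed.

Lemma dyadic_parent_cell k x :
  dyadic_parent (dyadic_cell k x) = dyadic_cell (k + 1) x.
Proof.
have [sub _] := (@dyadic_parentP R n (dyadic_cell k x) _).2 erefl.
exact/dyadic_cubeE/sub/mem_dyadic_cell.
Qed.

Lemma dyadic_childP q x : Q q x <-> exists e, Q (dyadic_child q e) x.
Proof.
split=> [/dyadic_cubeE qE|[e]].
  have [|e eE] := @dyadic_parent_eq q (dyadic_cell (q.1 - 1) x).
    by rewrite dyadic_parent_cell subrK.
  by exists e; rewrite -eE; exact: mem_dyadic_cell.
by have [+ _] := (@dyadic_parentP R n (dyadic_child q e) _).2 erefl;
  rewrite dyadic_childK; apply.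
Qed.

Lemma measurable_dyadic q : measurable (Q q).
Proof. exact: measurable_cube. Qed.
Hint Resolve measurable_dyadic : core.

(** The form of local integrability used throughout: it passes from a weight u
    to h u for h bounded and measurable, as is needed in the duality argument
    for p > 2. *)
Definition dyadic_integrable (f : V -> R) : Prop :=
  measurable_fun setT f /\ forall q, mu.-integrable (Q q) (EFin \o f).

Lemma locally_integrable_dyadic f :
  locally_integrable_Rn f -> dyadic_integrable f.
Proof.
by move=> lf; split=> [|q]; [exact: lf.1|exact: locally_integrable_cube].
Qed.

Lemma dyadic_cube_cubes q : cubes R n (Q q).
Proof. by do 2 eexists; last reflexivity; exact: dyadic_side_gt0. Qed.

Lemma dyadic_child_trivIset q : trivIset [set: E] (fun e => Q (dyadic_child q e)).
Proof.
move=> e e' _ _ [x [/dyadic_cubeE xe /dyadic_cubeE xe']].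
by apply: (@dyadic_child_inj q); rewrite xe xe'.
Qed.

Lemma dyadic_child_bigsetU q :
  \big[setU/set0]_(e <- index_enum E) Q (dyadic_child q e) = Q q.
Proof.
rewrite -bigcup_seq; apply/seteqP; split => [x [e _ xe]|x /dyadic_childP[e xe]].
  by apply/dyadic_childP; exists e.
by exists e => //=; rewrite mem_index_enum.
Qed.

Lemma ge0_integral_children q (f : V -> \bar R) : measurable_fun (Q q) f ->
  (forall x, Q q x -> 0 <= f x)%E ->
  (\int[mu]_(x in Q q) f x = \sum_e \int[mu]_(x in Q (dyadic_child q e)) f x)%E.
Proof.
move=> mf f0; rewrite -[in LHS](dyadic_child_bigsetU q) ge0_integral_bigsetU//=.
- exact: index_enum_uniq.
- exact: sub_trivIset (@dyadic_child_trivIset q).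
- by rewrite dyadic_child_bigsetU.
- by rewrite dyadic_child_bigsetU.
Qed.

Lemma integral_children q (f : V -> R) : dyadic_integrable f ->
  (\int[mu]_(x in Q q) f x = \sum_e \int[mu]_(x in Q (dyadic_child q e)) f x).
Proof.
move=> lf; apply: EFin_inj; rewrite -sumEFin.
have intf := lf.2.
have fin r : (\int[mu]_(x in Q r) f x)%:E = (\int[mu]_(x in Q r) (f x)%:E)%E.
  by rewrite fineK//; exact: integrable_fin_num.
rewrite fin; under eq_bigr do rewrite fin.
rewrite -[in LHS](dyadic_child_bigsetU q) integral_bigsetU_EFin//=.
- exact: index_enum_uniq.
- exact: sub_trivIset (@dyadic_child_trivIset q).
- by rewrite dyadic_child_bigsetU; exact: measurable_int (intf _).
Qed.

Definition dyadic_volume q : R := fine (mu (Q q)).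
Definition children_count : R := #|E|%:R.

Lemma children_count_ge1 : 1 <= children_count.
Proof. by rewrite /children_count ler1n card_ffun card_bool expn_gt0. Qed.

Lemma dyadic_volume_ge0 q : 0 <= dyadic_volume q.
Proof. exact: fine_ge0. Qed.

Lemma dyadic_volumeE q : (dyadic_volume q)%:E = mu (Q q).
Proof. by rewrite fineK// ge0_fin_numE//; exact: measure_cube_lty. Qed.

Lemma dyadic_volume_child q e :
  dyadic_volume q = children_count * dyadic_volume (dyadic_child q e).
Proof.
apply: EFin_inj; rewrite dyadic_volumeE -[LHS]mul1e -integral_cst//.
rewrite ge0_integral_children//.
rewrite (eq_bigr (fun=> (dyadic_volume (dyadic_child q e))%:E)).
  by rewrite sumEFin sumr_const mulr_natl.
move=> e' _; rewrite integral_cst// mul1e dyadic_volumeE.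
exact: measure_cube_translate.
Qed.

Lemma sum_average_children q (f : V -> R) : dyadic_integrable f ->
  \sum_e average (Q (dyadic_child q e)) f = children_count * average (Q q) f.
Proof.
move=> lf; rewrite /average -/(dyadic_volume _) (integral_children _ lf).
rewrite mulrA mulr_sumr; apply: eq_bigr => e _; congr (_ * _).
rewrite (dyadic_volume_child q e) -/(dyadic_volume _) invfM mulrA mulfV ?mul1r//.
by rewrite gt_eqF// (lt_le_trans ltr01)// children_count_ge1.
Qed.

(** On a null cube both sides vanish, in spite of the division by 0. *)
Lemma volume_average q (f : V -> R) : dyadic_integrable f ->
  dyadic_volume q * average (Q q) f = \int[mu]_(x in Q q) f x.
Proof.
move=> lf; rewrite /average -/(dyadic_volume q).
have [q0|q0] := eqVneq (dyadic_volume q) 0; last by rewrite mulrA mulfV// mul1r.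
rewrite q0 mul0r /Rintegral null_set_integral//.
- exact: measurable_funTS (measurableT_comp _ lf.1).
- exact: etrans (esym (dyadic_volumeE q)) (congr1 EFin q0).
Qed.

Lemma dyadic_integrable_normr (f : V -> R) :
  dyadic_integrable f -> dyadic_integrable (fun x => `|f x|).
Proof.
move=> [mf intf]; split=> [|q]; first exact: measurableT_comp.
exact/integrable_norm/intf.
Qed.

Lemma normr_average_le q (f : V -> R) : dyadic_integrable f ->
  `|average (Q q) f| <= average (Q q) (fun x => `|f x|).
Proof.
move=> lf; rewrite /average normrM ger0_norm ?invr_ge0 ?fine_ge0//.
rewrite ler_wpM2l ?invr_ge0 ?fine_ge0//.
exact: le_normr_Rintegral (measurable_dyadic q) (lf.2 q).
Qed.

(** A function of the cubes of a fixed level takes countably many values, on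
    unions of cubes. *)
Lemma measurable_dyadic_cell k (F : index -> R) :
  measurable_fun [set: V] (fun x => F (dyadic_cell k x)).
Proof.
move=> _ Y _; rewrite setTI.
rewrite (_ : _ @^-1` Y = \bigcup_(m in [set: 'rV[int]_n.+1])
  (if F (k, m) \in Y then Q (k, m) else set0)).
  apply: countable_bigcupT_measurable => // m.
  by case: ifP.
apply/seteqP; split => [x /= xY|x [m _] /=].
  by exists (dyadic_cell k x).2 => //; rewrite mem_set//; exact: mem_dyadic_cell.
by case: ifPn => // /set_mem ? /dyadic_cubeE <-.
Qed.

(** Numbers that are not the code of a position are sent to the empty set, so
    that the sequence is a partition of the space. *)
Definition level_cube (k : int) (i : nat) : set V :=
  if pickle_inv i is Some m then Q (k, m) else set0.

Lemma ge0_integral_level k (f : V -> \bar R) : measurable_fun setT f ->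
  (forall x, 0 <= f x)%E ->
  (\int[mu]_x f x = \sum_(i <oo) \int[mu]_(x in level_cube k i) f x)%E.
Proof.
move=> mf f0.
have lT : \bigcup_i level_cube k i = setT.
  apply/seteqP; split => // x _; exists (pickle (dyadic_cell k x).2) => //.
  by rewrite /level_cube pickleK_inv; exact: mem_dyadic_cell.
rewrite -[in LHS]lT ge0_integral_bigcup//.
- by move=> i; rewrite /level_cube; case: pickle_inv.
- by rewrite lT.
- move=> i j _ _ [x []]; rewrite /level_cube.
  have := @pickle_invK 'rV[int]_n.+1 i; case: pickle_inv => //= m1 <-.
  have := @pickle_invK 'rV[int]_n.+1 j; case: pickle_inv => //= m2 <-.
  by move=> /dyadic_cubeE/= h1 /dyadic_cubeE/= h2; have [->] : (k, m1) = (k, m2) by rewrite h1 h2.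
Qed.

End dyadic_geometry.

(** * The stopping rule *)

Section tree_sum.
Context {R : realType} {T : Type} {E : finType} (child : T -> E -> T).
Implicit Types F G : nat -> T -> R.

(** A finite sum over the tree of descendants of q. The summand receives the
    depth of a node besides the node, because the stopping rule below is a
    recursion on the depth. *)
Fixpoint tsum (N : nat) F (j : nat) (q : T) : R :=
  F j q + if N is N'.+1 then \sum_e tsum N' F j.+1 (child q e) else 0.

Lemma tsum_le N F G j q : (forall i r, F i r <= G i r) ->
  tsum N F j q <= tsum N G j q.
Proof.
move=> FG; elim: N j q => [|N IH] j q /=; rewrite lerD//.
by apply: ler_sum => e _; exact: IH.
Qed.

Lemma tsum_ge0 N F j q : (forall i r, 0 <= F i r) -> 0 <= tsum N F j q.
Proof.
by move=> F0; elim: N j q => [|N IH] j q /=; rewrite addr_ge0 ?sumr_ge0.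
Qed.

Lemma tsumD N F G j q :
  tsum N (fun i r => F i r + G i r) j q = tsum N F j q + tsum N G j q.
Proof.
elim: N j q => [|N IH] j q /=; first by rewrite !addr0.
by under eq_bigr do rewrite IH; rewrite big_split/= addrACA.
Qed.

Lemma tsumZ N F c j q : tsum N (fun i r => c * F i r) j q = c * tsum N F j q.
Proof.
elim: N j q => [|N IH] j q /=; first by rewrite !addr0.
by under eq_bigr do rewrite IH; rewrite -mulr_sumr mulrDr.
Qed.

Lemma tsum_sum N (k : nat) (F : nat -> nat -> T -> R) j q :
  tsum N (fun i r => \sum_(l < k) F l i r) j q = \sum_(l < k) tsum N (F l) j q.
Proof.
elim: N j q => [|N IH] j q /=.
  by rewrite addr0; apply: eq_bigr => l _; rewrite addr0.
under [X in _ + X]eq_bigr do rewrite IH.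
by rewrite exchange_big -big_split.
Qed.

End tree_sum.

Lemma sqr_le_norm (R : realDomainType) (x y : R) :
  `|x| <= y -> x ^+ 2 <= y ^+ 2.
Proof.
by move=> xy; rewrite -real_normK ?num_real// ler_sqr ?nnegrE// (le_trans _ xy).
Qed.

Section stopping.
Context {R : realType} {T : Type} {E : finType}.
Context (child : T -> E -> T) (parent : T -> T) (vol avg sgn : T -> R).
Local Notation g := (#|E|%:R : R).
Local Notation tsum := (tsum child).

Context (childK : forall q e, parent (child q e) = q).
Context (E0 : 1 <= g).
Context (vol_ge0 : forall q, 0 <= vol q).
Context (vol_child : forall q e, vol q = g * vol (child q e)).
Context (avg_child : forall q, \sum_e avg (child q e) = g * avg q).
Context (sgn_child : forall q, \sum_e sgn (child q e) = g * sgn q).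
Context (sgn_le : forall q, `|sgn q| <= avg q).

Let K := 64 * g ^+ 2.

(** The state at a node consists of the average of |f| at the last stop (above the
    node or at it), the squares accumulated since then, and the flag that tells
    whether the process stops at this node. The constant K is large enough for the
    two terms of the potential at a starting node to be at most 1/4 each. *)
Fixpoint stop_state (j : nat) (q : T) : R * R * bool :=
  if j is i.+1 then
    let '(a, s, _) := stop_state i (parent q) in
    let s' := s + (sgn q - sgn (parent q)) ^+ 2 in
    if (4 * a < avg q) || (K * a ^+ 2 < s') then (avg q, 0, true)
    else (a, s', false)
  else (avg q, 0, true).

Definition stopped j q := (stop_state j q).2.
Local Notation height j q := (stop_state j q).1.1.
Local Notation acc j q := (stop_state j q).1.2.

Let avg_ge0 q : 0 <= avg q.
Proof. exact: le_trans (sgn_le q). Qed.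

Let K0 : 0 <= K. Proof. by rewrite mulr_ge0// sqr_ge0. Qed.

Lemma stop_stateP j q : [/\ 0 <= height j q, avg q <= 4 * height j q,
   0 <= acc j q & acc j q <= K * height j q ^+ 2].
Proof.
have start : [/\ 0 <= avg q, avg q <= 4 * avg q, (0 : R) <= 0
   & 0 <= K * avg q ^+ 2].
  by split => //; [have := avg_ge0 q; lra|rewrite mulr_ge0// sqr_ge0].
elim: j q start => [//|j IH] q start /=.
have [] := IH (parent q).
  by split => //; [have := avg_ge0 (parent q); lra|rewrite mulr_ge0// sqr_ge0].
case: (stop_state j (parent q)) => [[a s] b] /= a0 Aa s0 sK.
case: ifPn => [_ //|]; rewrite negb_or -!leNgt => /andP[h1 h2] /=.
by split => //; rewrite addr_ge0// sqr_ge0.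
Qed.

Lemma stopped_height j q : stopped j q -> height j q = avg q /\ acc j q = 0.
Proof.
rewrite /stopped; case: j => [//|j] /=.
by case: (stop_state j (parent q)) => [[a s] b]; case: ifP.
Qed.

(** Between two stops the sum of the squares is at most K a^2, where a is the
    average at the first of them. The square at the stop itself is at most
    32 a^2 + 2 A^2, where A is the new average, because no average before the stop
    exceeds 4 a. The claim carries the unused part of K a^2 along the chain. *)
Lemma pointwise_domination (c : nat -> T) N :
  (forall i, parent (c i.+1) = c i) ->
  \sum_(i < N) (sgn (c i.+1) - sgn (c i)) ^+ 2 <=
  (K + 34) * \sum_(i < N.+1) (stopped i (c i))%:R * avg (c i) ^+ 2.
Proof.
move=> cP.
(* Strengthened for the induction; the last term is nonnegative by stop_stateP. *)
suff : \sum_(i < N) (sgn (c i.+1) - sgn (c i)) ^+ 2 +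
    ((K + 32) * height N (c N) ^+ 2 - acc N (c N)) <=
  (K + 34) * \sum_(i < N.+1) (stopped i (c i))%:R * avg (c i) ^+ 2.
  apply: le_trans; rewrite lerDl.
  have [_ _ _] := stop_stateP N (c N).
  by have := sqr_ge0 (height N (c N)); nra.
elim: N => [|N IH].
  rewrite big_ord0 big_ord_recl big_ord0 /stopped/=.
  by have := sqr_ge0 (avg (c 0%N)); nra.
rewrite big_ord_recr [X in _ <= _ * X]big_ord_recr/=.
have := stop_stateP N (c N).
move: IH; rewrite /stopped/= cP.
case: (stop_state N (c N)) => [[a s] b] /=.
set X := \sum_(i < N) _; set Y := \sum_(i < N.+1) _; move=> IH [a0 Aa s0 sK].
have := sgn_le (c N.+1); have := sgn_le (c N); rewrite !ler_norml.
move=> /andP[l1 l2] /andP[l3 l4].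
have Z0 := avg_ge0 (c N.+1); have A0 := avg_ge0 (c N).
have d1 : sgn (c N) ^+ 2 <= 16 * a ^+ 2 by nra.
have d2 : sgn (c N.+1) ^+ 2 <= avg (c N.+1) ^+ 2 by nra.
have d : (sgn (c N.+1) - sgn (c N)) ^+ 2 <= 32 * a ^+ 2 + 2 * avg (c N.+1) ^+ 2.
  have : 0 <= (sgn (c N.+1) + sgn (c N)) ^+ 2 by exact: sqr_ge0.
  nra.
by case: ifP => _ /=; nra.
Qed.

(** The potential of the stopping rule: the first term measures how close avg is
    to the first threshold, the second one how close the accumulated squares are
    to the second. Both avg and s - sgn^2 are martingales along the tree, so P is
    one too (P_child); the last summand makes P nonnegative. *)
Let P (a s : R) q := vol q * (avg q * (4 * a)^-1 +
  (s - sgn q ^+ 2 + 16 * g ^+ 2 * a ^+ 2) * (K * a ^+ 2)^-1).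

Let P_child a s q :
  \sum_e P a (s + (sgn (child q e) - sgn q) ^+ 2) (child q e) = P a s q.
Proof.
have g0 : g != 0 by rewrite gt_eqF// (lt_le_trans ltr01).
rewrite /P; move: (_^-1) (_^-1) => y x.
have v e : vol (child q e) = g^-1 * vol q by rewrite (vol_child q e) mulKf.
under eq_bigr do rewrite v.
rewrite -mulr_sumr.
rewrite (eq_bigr (fun e => avg (child q e) * x - (2 * sgn q * y) * sgn (child q e)
   + (s + sgn q ^+ 2 + 16 * g ^+ 2 * a ^+ 2) * y)); last first.
  by move=> e _; ring.
rewrite !big_split/= sumrN -mulr_suml -mulr_sumr avg_child sgn_child.
rewrite sumr_const -[_ *+ #|E|]mulr_natl.
by field.
Qed.

Lemma avg_child_le q e : avg (child q e) <= g * avg q.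
Proof. by rewrite -avg_child (bigD1 e)//= lerDl sumr_ge0. Qed.

Lemma sgn_child_sqr q e a : avg q <= 4 * a ->
  sgn (child q e) ^+ 2 <= 16 * g ^+ 2 * a ^+ 2.
Proof.
move=> qa; have := sgn_le (child q e); have := avg_child_le q e.
rewrite ler_norml => h1 /andP[h2 h3].
have h4 : avg (child q e) <= g * (4 * a).
  by apply: le_trans h1 _; rewrite ler_wpM2l// (le_trans ler01).
have : sgn (child q e) ^+ 2 <= (g * (4 * a)) ^+ 2.
  by apply: sqr_le_norm; rewrite ler_norml; lra.
by congr (_ <= _); ring.
Qed.

Let P_start q : P (avg q) 0 q <= vol q / 2.
Proof.
rewrite /P; have [->|A0] := eqVneq (avg q) 0.
  by rewrite expr0n/= !mulr0 invr0 !mulr0 addr0 mulr0 divr_ge0.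
have gp : 0 < g by exact: lt_le_trans E0.
have Ap : 0 < avg q by rewrite lt_def A0 avg_ge0.
rewrite ler_wpM2l//.
have -> : avg q * (4 * avg q)^-1 = 4^-1 by field.
have : (0 - sgn q ^+ 2 + 16 * g ^+ 2 * avg q ^+ 2) * (K * avg q ^+ 2)^-1 <= 4^-1.
  rewrite ler_pdivrMr; last by rewrite !mulr_gt0// exprn_gt0.
  by rewrite /K; have := sqr_ge0 (sgn q); nra.
lra.
Qed.

(** At a cube where the process stops, the potential is at least the volume
    (one of the two terms is at least 1 there), and it starts again from at most
    half of the volume ([P_start]). Hence twice the potential pays for the cube and
    for the potential after the restart; the total is kept by [P_child]. *)
Lemma stopped_descendants N j q :
  \sum_e tsum N (fun i r => (stopped i r)%:R * vol r) j.+1 (child q e) <=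
  2 * P (height j q) (acc j q) q.
Proof.
rewrite -P_child mulr_sumr.
have gp : 0 < g by exact: lt_le_trans E0.
have main N0 j0 q0 e : (forall j q,
    tsum N0 (fun i r => (stopped i r)%:R * vol r) j q <=
      (stopped j q)%:R * vol q + 2 * P (height j q) (acc j q) q) ->
   tsum N0 (fun i r => (stopped i r)%:R * vol r) j0.+1 (child q0 e) <=
   2 * P (height j0 q0) (acc j0 q0 + (sgn (child q0 e) - sgn q0) ^+ 2) (child q0 e).
  move=> /(_ j0.+1 (child q0 e))/le_trans; apply.
  rewrite /stopped/= childK; have := stop_stateP j0 q0.
  case: (stop_state j0 q0) => [[a s] b] /= [a0 Aa s0 sK].
  case: ifPn => [/orP stop|_] /=; last by rewrite mul0r add0r.
  rewrite mul1r; have := P_start (child q0 e).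
  suff : vol (child q0 e) <=
     P a (s + (sgn (child q0 e) - sgn q0) ^+ 2) (child q0 e) by lra.
  rewrite /P -[leLHS]mulr1 ler_wpM2l//.
  (* If a = 0 then f vanishes on the cube and neither threshold is exceeded. *)
  have ap : 0 < a.
    rewrite lt_def a0 andbT; apply/eqP => az.
    have qz : avg q0 = 0 by have := avg_ge0 q0; lra.
    have cz : avg (child q0 e) = 0.
      by have := avg_ge0 (child q0 e); have := avg_child_le q0 e; rewrite qz mulr0; lra.
    have sz r : avg r = 0 -> sgn r = 0.
      by move=> rz; apply/eqP; rewrite -normr_eq0 eq_le normr_ge0 andbT -rz.
    case: stop; rewrite az ?cz ?(sz _ qz) ?(sz _ cz) ?expr0n ?mulr0 ?ltxx//=.
    by rewrite subrr expr0n addr0; move: sK; rewrite az expr0n mulr0 leNgt => /negbTE ->.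
  have sb := sgn_child_sqr e Aa.
  have Kp : 0 < K * a ^+ 2 by rewrite !mulr_gt0// exprn_gt0.
  have h1 : 0 <= avg (child q0 e) * (4 * a)^-1.
    by rewrite mulr_ge0// invr_ge0 mulr_ge0.
  move: stop; set t := s + _ => stop; have t0 : 0 <= t by rewrite addr_ge0// sqr_ge0.
  have h2 : 0 <= (t - sgn (child q0 e) ^+ 2 + 16 * g ^+ 2 * a ^+ 2) * (K * a ^+ 2)^-1.
    by rewrite mulr_ge0// ?invr_ge0 ?(ltW Kp)//; lra.
  case: stop => stop.
    suff : 1 <= avg (child q0 e) * (4 * a)^-1 by lra.
    by rewrite ler_pdivlMr ?mul1r ?(ltW stop)// mulr_gt0.
  suff : 1 <= (t - sgn (child q0 e) ^+ 2 + 16 * g ^+ 2 * a ^+ 2) * (K * a ^+ 2)^-1.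
    by lra.
  by rewrite ler_pdivlMr// mul1r; lra.
elim: N j q => [|N IH] j q; apply: ler_sum => e _; apply: main => i r /=.
  rewrite lerD2l mulr_ge0// /P mulr_ge0//.
  have [h0 Ah a0 aK] := stop_stateP i r.
  rewrite addr_ge0// mulr_ge0// ?invr_ge0 ?mulr_ge0 ?sqr_ge0//.
  have : sgn r ^+ 2 <= avg r ^+ 2 by exact: sqr_le_norm.
  have : avg r ^+ 2 <= (4 * height i r) ^+ 2 by rewrite ler_sqr ?nnegrE// mulr_ge0.
  have : 1 <= g ^+ 2 by rewrite expr_ge1.
  move: (g ^+ 2) (sqr_ge0 (height i r)) => G; rewrite exprMn; nra.
by rewrite lerD2l -P_child mulr_sumr.
Qed.

Lemma carleson N j q : stopped j q ->
  tsum N (fun i r => (stopped i r)%:R * vol r) j q <= 2 * vol q.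
Proof.
move=> sq; case: N => [|N] /=; rewrite sq mul1r.
  by rewrite addr0; have := vol_ge0 q; lra.
have := stopped_descendants N j q; have [-> ->] := stopped_height sq.
by have := P_start q; lra.
Qed.

End stopping.

(** * Young functions and the B_r condition *)

Section young.
Context {R : realType} (B : R -> R) (hB : young_function B).
Local Notation Phi := (young_associate B).

Let conj_set (t : R) : set R := [set s * t - B s | s in [set` `]0, +oo[]].

(** Superlinearity: B s >= t s for large s, so only bounded s matter. *)
Lemma young_associate_has_sup t : 0 <= t -> has_sup (conj_set t).
Proof.
move=> t0; split; first by exists (1 * t - B 1), 1 => //=; rewrite in_itv/= ltr01.
have [M [_ HM]] := (cvgryPge _).1 (young_superlinear hB) t.
exists (Num.max 0 (M + 1) * t) => _ [s /= + <-]; rewrite in_itv/= andbT => s0.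
have Bs0 := young_ge0 hB (ltW s0).
have [sM|Ms] := leP s (M + 1).
  by have : s * t <= Num.max 0 (M + 1) * t;
    [rewrite ler_wpM2r// le_max sM orbT|lra].
have Ms' : M < s by lra.
have := HM s Ms'; rewrite ler_pdivlMr// => tB.
have : 0 <= Num.max 0 (M + 1) * t by rewrite mulr_ge0// le_max lexx.
by rewrite mulrC in tB; lra.
Qed.

Lemma young_inequality_pos s t : 0 < s -> 0 <= t -> s * t <= Phi t + B s.
Proof.
move=> s0 t0; rewrite -lerBlDr; apply: sup_upper_bound.
  exact: young_associate_has_sup.
by exists s => //=; rewrite in_itv/= s0.
Qed.

Lemma young_le_linear s : 0 <= s <= 1 -> B s <= s * B 1.
Proof.
move=> /andP[s0 s1].
have : B (s * 1 + (1 - s) * 0) <= s * B 1 + (1 - s) * B 0.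
  have := @young_convex _ _ hB (Itv01 s0 s1) 1 0.
  by rewrite !inE/= !in_itv/= !lexx ler01/= => /(_ isT isT).
by rewrite mulr1 mulr0 addr0 (young0 hB) mulr0 addr0.
Qed.

(** The supremum is over s > 0; the value 0 at s = 0 is approached because
    B s <= s B 1 near 0, by convexity. *)
Lemma young_associate_ge0 t : 0 <= t -> 0 <= Phi t.
Proof.
move=> t0; have B1 := young_ge0 hB ler01.
apply/ler_addgt0Pr => e e0.
pose s := Num.min 1 (e / (B 1 + 1)).
have s0 : 0 < s by rewrite lt_min ltr01 divr_gt0//; lra.
have s1 : 0 <= s <= 1 by rewrite (ltW s0) ge_min lexx.
have := young_inequality_pos s0 t0; have := young_le_linear s1.
have : s * (B 1 + 1) <= e by rewrite -ler_pdivlMr ?ge_min ?lexx ?orbT//; lra.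
have := mulr_ge0 (ltW s0) t0; rewrite mulrDr mulr1; lra.
Qed.

Lemma young_inequality s t : 0 <= s -> 0 <= t -> s * t <= Phi t + B s.
Proof.
rewrite le_eqVlt => /predU1P[<- t0|]; last exact: young_inequality_pos.
by rewrite mul0r (young0 hB) addr0 young_associate_ge0.
Qed.

Lemma young_associate_le s t : 0 <= s -> s <= t -> Phi s <= Phi t.
Proof.
move=> s0 st; apply: ge_sup; first by have [] := young_associate_has_sup s0.
move=> _ [x /= + <-]; rewrite in_itv/= andbT => x0.
rewrite lerBlDr (le_trans _ (young_inequality_pos x0 (le_trans s0 st)))//.
by rewrite ler_wpM2l// ltW.
Qed.

Lemma young_associate_scale e t : 0 <= e <= 1 -> 0 <= t -> Phi (e * t) <= e * Phi t.
Proof.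
move=> /andP[e0 e1] t0; apply: ge_sup.
  by have [] := young_associate_has_sup (mulr_ge0 e0 t0).
move=> _ [x /= + <-]; rewrite in_itv/= andbT => x0.
have := ler_wpM2l e0 (young_inequality_pos x0 t0).
have := mulr_ge0 e0 (young_ge0 hB (ltW x0)).
have e1' : 0 <= 1 - e by rewrite subr_ge0.
have := mulr_ge0 e1' (young_ge0 hB (ltW x0)).
by rewrite mulrDr mulrBl mul1r mulrCA; lra.
Qed.

End young.

Section dyadic_tail.
Context {R : realType} (r : R) (phi : R -> R).
Context (r0 : 0 < r) (phi0 : forall t, 0 <= phi t).
Context (phi_nd : {homo phi : s t / s <= t}).
Local Notation leb := (@lebesgue_measure R).

(** The integrand of the B_r condition, written with powers so as to be measurable
    on the whole line. *)
Let dens (t : R) : \bar R := (phi t * t `^ (- r) * t `^ (- 1))%:E.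

Let mphi : measurable_fun [set: R] phi.
Proof. exact: nondecreasing_measurable. Qed.

Let mdens (D : set R) : measurable_fun D dens.
Proof.
apply/measurable_funTS/measurableT_comp => //.
apply: measurable_funM; last exact: measurable_powR.
by apply: measurable_funM => //; exact: measurable_powR.
Qed.

Let densE t : 0 <= t -> dens t = (phi t / t `^ r / t)%:E.
Proof. by move=> t0; rewrite /dens powRN powR_inv1. Qed.

Let dens0 t : 0 <= t -> (0 <= dens t)%E.
Proof.
by move=> t0; rewrite lee_fin !mulr_ge0// powR_ge0.
Qed.

Let mass (a b : R) : \bar R :=
  (\int[leb]_(x in [set` `[a, b[]) dens x)%E.
Let tail (a : R) : \bar R :=
  (\int[leb]_(x in [set` `[a, +oo[]) dens x)%E.

(** On [t, 2 t[ the density is at least phi t / (2 t)^r / (2 t). *)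
Let block t : 0 < t ->
  ((phi t / t `^ r)%:E <= (2 `^ (r + 1))%:E * mass t (2 * t))%E.
Proof.
move=> t0.
have t2 : 0 < 2 * t by rewrite mulr_gt0.
pose m : R := phi t / (2 * t) `^ r / (2 * t).
have m0 : 0 <= m.
  by rewrite /m !mulr_ge0// invr_ge0// ?powR_ge0// mulr_ge0// ltW.
have : ((m * t)%:E <= mass t (2 * t))%E.
  rewrite (_ : (m * t)%:E = \int[leb]_(x in [set` `[t, (2 * t)%R[]) m%:E)%E; last first.
    rewrite integral_cst//= lebesgue_measure_itv/= lte_fin ifT; last by lra.
    by rewrite -EFinD -EFinM; congr (_ * _)%:E; lra.
  apply: ge0_le_integral => //; first exact: mdens.
  move=> x /=; rewrite in_itv/= => /andP[tx x2t].
  have x0 : 0 < x by exact: lt_le_trans tx.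
  rewrite densE ?(ltW x0)// lee_fin /m ler_pM ?invr_ge0 ?mulr_ge0 ?invr_ge0 ?powR_ge0 ?(ltW t0)//.
    rewrite ler_pM ?invr_ge0 ?powR_ge0 ?phi_nd//.
    by rewrite lef_pV2 ?posrE ?powR_gt0// ge0_ler_powR ?nnegrE ?ltW.
  by rewrite lef_pV2 ?posrE// ltW.
have p0 : (0 <= (2 `^ (r + 1))%:E :> \bar R)%E by rewrite lee_fin powR_ge0.
move=> /(lee_wpmul2l p0)/(le_trans _); apply.
rewrite -EFinM lee_fin /m powRM ?(ltW t0)// powRD ?pnatr_eq0 ?implybT// powRr1//.
rewrite le_eqVlt; apply/orP; left; apply/eqP.
have h1 : t `^ r != 0 by rewrite gt_eqF// powR_gt0.
have h2 : (2:R) `^ r != 0 by rewrite gt_eqF// powR_gt0.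
by field; rewrite h1 h2 gt_eqF.
Qed.

Let tail_ge0 a : 0 < a -> (0 <= tail a)%E.
Proof.
move=> a0; apply: integral_ge0 => x /=; rewrite in_itv/= andbT => ax.
by rewrite dens0//; lra.
Qed.

Let tail_split a b : 0 < a -> a <= b -> (tail a = mass a b + tail b)%E.
Proof.
move=> a0 ab; rewrite /tail /mass -ge0_integral_setU//=.
- by congr integral; rewrite -itv_bndbnd_setU// bnd_simp.
- exact: mdens.
- move=> x /= []; rewrite in_itv/=; first by move=> /andP[tx _]; rewrite dens0//; lra.
  by rewrite andbT => tx; rewrite dens0//; lra.
- rewrite disj_set2E; apply/eqP/seteqP; split => // x /= [].
  by rewrite !in_itv/= => /andP[_ h1] /andP[h2 _]; lra.
Qed.

Let mass_ge0 a b : 0 < a -> (0 <= mass a b)%E.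
Proof.
move=> a0; apply: integral_ge0 => x /=; rewrite in_itv/= => /andP[ax _].
by rewrite dens0//; lra.
Qed.

Let sum_mass s M : 0 < s ->
  (\sum_(l < M) mass (s * 2 ^+ l) (2 * (s * 2 ^+ l)) <= tail s)%E.
Proof.
elim: M s => [|M IH] s s0; first by rewrite big_ord0 tail_ge0.
rewrite big_ord_recl expr0 mulr1 (@tail_split s (2 * s)) ?leeD2l//; last lra.
have s20 : 0 < 2 * s by rewrite mulr_gt0.
apply: le_trans (IH _ s20); rewrite le_eqVlt; apply/orP; left; apply/eqP.
by apply: eq_bigr => l _; rewrite lift0 exprS; congr (mass _ _); ring.
Qed.

Let sum_mass_cut c s M : 0 < c -> 0 < s ->
  (\sum_(l < M | (c < s * 2 ^+ l)%R) mass (s * 2 ^+ l) (2 * (s * 2 ^+ l)) <=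
   tail c)%E.
Proof.
move=> c0; elim: M s => [|M IH] s s0; first by rewrite big_ord0 tail_ge0.
have [sc|cs] := leP s c.
  rewrite big_mkcond big_ord_recl expr0 mulr1 ltNge sc/= add0e -big_mkcond/=.
  have s20 : 0 < 2 * s by rewrite mulr_gt0.
  apply: le_trans (IH _ s20); rewrite le_eqVlt; apply/orP; left; apply/eqP.
  have e l : s * 2 ^+ bump 0 l = 2 * s * 2 ^+ l by rewrite /bump exprS; ring.
  by apply: eq_big => [l|l _]; rewrite e.
rewrite (@tail_split c s) ?(ltW cs)//.
apply: (@le_trans _ _ (tail s)); last by rewrite leeDr// mass_ge0.
apply: le_trans (sum_mass M.+1 s0); rewrite big_mkcond; apply: lee_sum => l _.
by case: ifP => // _; rewrite mass_ge0// mulr_gt0// exprn_gt0.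
Qed.

(** Decreasing in l, so that the ratios of a fixed number to these heights
    increase geometrically, as in the sums over blocks above. *)
Definition dyadic_height (L l : nat) : R := 2 ^+ L / 2 ^+ l.

Lemma dyadic_height_gt0 L l : 0 < dyadic_height L l.
Proof. by rewrite divr_gt0// exprn_gt0. Qed.

(** The l-th term is y^r phi(t) / t^r at t = y / dyadic_height L l. These points are
    in geometric progression, so the intervals [t, 2 t[ are disjoint, and the terms
    that are kept by the cut have t > c, where c comes from the B_r condition. *)
Lemma dyadic_tail_sum : Bcond r phi -> exists c C : R, [/\ 0 < c, 0 < C &
  forall L M y, 0 <= y ->
    \sum_(l < M) dyadic_height L l `^ r *
      (if c * dyadic_height L l < y then phi (y / dyadic_height L l) else 0)
    <= C * y `^ r].
Proof.
move=> [c c0 finB]; exists c; exists (2 `^ (r + 1) * fine (tail c) + 1).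
have {}finB : (tail c < +oo)%E.
  apply: le_lt_trans finB; rewrite le_eqVlt; apply/orP; left; apply/eqP.
  apply: eq_integral => t.
  by rewrite inE/= in_itv/= andbT => ct; rewrite densE// (le_trans (ltW c0)).
have tc : tail c = (fine (tail c))%:E.
  by rewrite fineK// ge0_fin_numE// tail_ge0.
have C0 : 0 <= 2 `^ (r + 1) * fine (tail c).
  by rewrite mulr_ge0 ?powR_ge0// fine_ge0// tail_ge0.
split => //; first lra.
move=> L M y; rewrite le_eqVlt => /predU1P[<-|y0].
  rewrite powR0 ?gt_eqF// mulr0 big1// => l _.
  by rewrite ltNge mulr_ge0 ?(ltW c0) ?(ltW (dyadic_height_gt0 _ _))//= mulr0.
apply: (@le_trans _ _ (2 `^ (r + 1) * fine (tail c) * y `^ r)); last first.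
  by rewrite ler_wpM2r ?powR_ge0//; lra.
pose s := y / 2 ^+ L.
have s0 : 0 < s by rewrite divr_gt0// exprn_gt0.
have sE l : y / dyadic_height L l = s * 2 ^+ l.
  by rewrite /dyadic_height invf_div mulrA mulrAC.
rewrite -lee_fin -sumEFin mulrAC EFinM -tc.
have k0 : (0 <= (2 `^ (r + 1) * y `^ r)%:E :> \bar R)%E.
  by rewrite lee_fin mulr_ge0// powR_ge0.
apply: le_trans (lee_wpmul2l k0 (sum_mass_cut M c0 s0)).
rewrite ge0_sume_distrr; last first.
  by move=> l _; rewrite mass_ge0// mulr_gt0// exprn_gt0.
rewrite [leRHS]big_mkcond/=; apply: lee_sum => l _.
have h0 := dyadic_height_gt0 L l.
rewrite -ltr_pdivlMr// sE; case: ifPn => [cs|_]; last by rewrite mulr0.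
have t0 : 0 < s * 2 ^+ l by rewrite mulr_gt0// exprn_gt0.
rewrite [2 `^ (r + 1) * y `^ r]mulrC [X in (_ <= X * _)%E]EFinM -muleA.
have y0' : (0 <= (y `^ r)%:E :> \bar R)%E by rewrite lee_fin powR_ge0.
apply: le_trans (lee_wpmul2l y0' (block t0)).
rewrite -EFinM lee_fin.
have -> : y = dyadic_height L l * (s * 2 ^+ l) by rewrite -sE mulrCA mulfV ?mulr1// gt_eqF.
rewrite powRM ?(ltW h0) ?(ltW t0)//.
rewrite -[leRHS]mulrA; apply: ler_wpM2l; first exact: powR_ge0.
by rewrite mulrCA mulfV ?mulr1// gt_eqF// powR_gt0.
Qed.

(** The largest height below a already gives half of a; L has to be so large that
    a lies in the range of the heights. *)
Lemma dyadic_layers (a : R) : 0 <= a -> \forall L \near \oo,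
  a `^ r <= 2 `^ r * \sum_(l < L.*2.+1)
    (dyadic_height L l <= a)%R%:R * dyadic_height L l `^ r.
Proof.
rewrite le_eqVlt => /predU1P[<-|a0].
  apply: nearW => L; rewrite powR0 ?gt_eqF// mulr_ge0 ?powR_ge0// sumr_ge0// => l _.
  by rewrite mulr_ge0 ?powR_ge0.
have two (x : R) : exists L0 : nat, forall L, (L0 <= L)%N -> x <= 2 ^+ L.
  have [k xk] : exists k : nat, x <= k%:R.
    have [x0|x0] := leP x 0; first by exists 0%N.
    by exists (Num.truncn x).+1; rewrite ltW// truncnS_gt.
  exists k => L kL; apply: le_trans xk _.
  rewrite -natrX ler_nat; apply: leq_trans kL _.
  exact/ltnW/ltn_expl.
have [L1 H1] := two a; have [L2 H2] := two a^-1.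
exists (maxn L1 L2) => // L /=; rewrite geq_max => /andP[/H1 aL /H2 aL'].
have lL : dyadic_height L L.*2 <= a.
  rewrite /dyadic_height -addnn exprD invfM mulrA mulfV ?mul1r.
    by rewrite -[leRHS]invrK lef_pV2 ?posrE ?exprn_gt0 ?invr_gt0.
  by rewrite gt_eqF// exprn_gt0.
have ex : exists l, dyadic_height L l <= a by exists L.*2.
have [l la lmin] := ex_minnP ex.
have lL2 : (l < L.*2.+1)%N by rewrite ltnS lmin.
have al : a <= 2 * dyadic_height L l.
  case: l la lmin {lL2} => [|l] la lmin.
    by rewrite /dyadic_height expr0 divr1; have := exprn_gt0 L (ltr0n R 2); lra.
  have : ~~ (dyadic_height L l <= a) by apply/negP => /lmin; rewrite ltnn.
  rewrite -ltNge => /ltW/le_trans; apply.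
  by rewrite /dyadic_height exprS invfM mulrCA [2 * _]mulrA mulfV// mul1r.
rewrite (bigD1 (Ordinal lL2))//= la mul1r mulrDr.
apply: (@le_trans _ _ (2 `^ r * dyadic_height L l `^ r)); last first.
  rewrite lerDl mulr_ge0 ?powR_ge0// sumr_ge0// => i _.
  by rewrite mulr_ge0// powR_ge0.
rewrite -powRM ?(ltW (dyadic_height_gt0 _ _))//.
have h0 := dyadic_height_gt0 L l.
by apply: ge0_ler_powR; rewrite ?nnegrE// ltW// mulr_gt0.
Qed.

End dyadic_tail.

(** * Integrals of nonnegative functions *)

Section real_integrals.
Context d (T : measurableType d) (R : realType).
Context {m : {measure set T -> \bar R}} {D : set T} (mD : measurable D).
Implicit Types f g : T -> R.

Lemma measurable_EFin_fun (A : set T) f :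
  measurable_fun setT f -> measurable_fun A (fun x => (f x)%:E).
Proof. by move=> mf; apply: measurable_funTS; exact/measurable_EFinP. Qed.

Lemma measurable_powR_fun f s :
  measurable_fun setT f -> measurable_fun setT (fun x => f x `^ s).
Proof.
by move=> mf; apply: (@measurableT_comp _ _ _ _ _ _ (fun z : R => z `^ s)).
Qed.

Lemma measurable_scale_fun f c :
  measurable_fun setT f -> measurable_fun setT (fun x => f x * c).
Proof. by move=> mf; exact: measurable_funM. Qed.

Lemma measurable_nd_fun f (phi : R -> R) : {homo phi : s t / s <= t} ->
  measurable_fun setT f -> measurable_fun setT (fun x => phi (f x)).
Proof.
move=> nd mf; apply: (@measurableT_comp _ _ _ _ _ _ phi) => //.
exact: nondecreasing_measurable.
Qed.

Lemma measurable_cut_fun f g c : measurable_fun setT f -> measurable_fun setT g ->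
  measurable_fun setT (fun x => if c < f x then g x else 0).
Proof.
move=> mf mg; apply: measurable_fun_ifT => //.
exact: measurable_fun_ltr.
Qed.

Lemma ge0_le_integral_real f g : measurable_fun setT f -> measurable_fun setT g ->
  (forall x, 0 <= f x) -> (forall x, D x -> f x <= g x) ->
  (\int[m]_(x in D) (f x)%:E <= \int[m]_(x in D) (g x)%:E)%E.
Proof.
move=> mf mg f0 fg; apply: ge0_le_integral => //.
- by move=> x _; rewrite lee_fin.
- exact: measurable_EFin_fun.
- exact: measurable_EFin_fun.
Qed.

Lemma ge0_integralD_real f g : measurable_fun setT f -> measurable_fun setT g ->
  (forall x, 0 <= f x) -> (forall x, 0 <= g x) ->
  (\int[m]_(x in D) (f x + g x)%:E =
   \int[m]_(x in D) (f x)%:E + \int[m]_(x in D) (g x)%:E)%E.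
Proof.
move=> mf mg f0 g0; rewrite -ge0_integralD//.
- by move=> x _; rewrite lee_fin.
- exact: measurable_EFin_fun.
- by move=> x _; rewrite lee_fin.
- exact: measurable_EFin_fun.
Qed.

Lemma ge0_integralZ_real f c : measurable_fun setT f ->
  (forall x, 0 <= f x) -> 0 <= c ->
  (\int[m]_(x in D) (c * f x)%:E = c%:E * \int[m]_(x in D) (f x)%:E)%E.
Proof.
move=> mf f0 c0; rewrite -ge0_integralZl_EFin//.
- by move=> x _; rewrite lee_fin.
- exact: measurable_EFin_fun.
Qed.

Lemma ge0_integral_sum_real k (f : 'I_k -> T -> R) :
  (forall l, measurable_fun setT (f l)) -> (forall l x, 0 <= f l x) ->
  (\int[m]_(x in D) (\sum_(l < k) f l x)%:E =
   \sum_(l < k) \int[m]_(x in D) (f l x)%:E)%E.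
Proof.
move=> mf f0; rewrite -ge0_integral_sum//.
- by apply: eq_integral => x _; rewrite sumEFin.
- by move=> l; exact: measurable_EFin_fun.
- by move=> l x _; rewrite lee_fin.
Qed.

Lemma integral_real_ge0 f : (forall x, 0 <= f x) ->
  (0 <= \int[m]_(x in D) (f x)%:E)%E.
Proof. by move=> f0; apply: integral_ge0 => x _; rewrite lee_fin. Qed.

End real_integrals.

(** * The Carleson embedding *)

Section near_tsum.
Context {R : realType} {T : Type} {E : finType} (child : T -> E -> T).

Lemma near_tsum_le N (F : nat -> T -> R) (G : nat -> nat -> T -> R) j q :
  (forall i s, \forall L \near \oo, F i s <= G L i s) ->
  \forall L \near \oo, tsum child N F j q <= tsum child N (G L) j q.
Proof.
move=> FG; elim: N j q => [|N IH] j q.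
  by apply: filterS (FG j q) => L; rewrite /= lerD2r.
have H : \forall L \near \oo, forall e,
    tsum child N F j.+1 (child q e) <= tsum child N (G L) j.+1 (child q e).
  by apply: filter_forall => e; exact: IH.
near=> L; rewrite /= lerD//; first by near: L.
by apply: ler_sum => e _; move: e; near: L.
Unshelve. all: by end_near. Qed.

End near_tsum.

Section embedding.
Context {R : realType} {n : nat} (r : R) (Phi : R -> R).
Context (r0 : 0 < r) (Phi0 : forall t, 0 <= Phi t).
Context (Phi_nd : {homo Phi : s t / s <= t}).
Context (Phi_scale : forall e t, 0 <= e <= 1 -> 0 <= t -> Phi (e * t) <= e * Phi t).
Local Notation V := (Rn R n).
Local Notation mu := (@lebesgueRn R n).
Local Notation index := (@dyadic_index n).
Local Notation Q := (@dyadic_cube R n).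
Local Notation vol := (@dyadic_volume R n).
Local Notation tsum := (tsum (@dyadic_child n)).

Lemma measurable_ratio (g : V -> R) (l : R) :
  measurable_fun [set: V] g -> measurable_fun [set: V] (fun x => Phi (g x / l)).
Proof. by move=> mg; apply: measurable_nd_fun => //; exact: measurable_scale_fun. Qed.

Let trunc (g : V -> R) (c l : R) (x : V) : R :=
  if c * l < g x then Phi (g x / l) else 0.

Let trunc_ge0 g c l x : 0 <= trunc g c l x.
Proof. by rewrite /trunc; case: ifP. Qed.

Let measurable_trunc (g : V -> R) (c l : R) :
  measurable_fun [set: V] g -> measurable_fun [set: V] (trunc g c l).
Proof.
by move=> mg; apply: measurable_cut_fun; [exact: mg|exact: measurable_ratio].
Qed.

Let mQ q : measurable (Q q). Proof. exact: measurable_dyadic. Qed.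

Context (S : nat -> index -> bool) (g : V -> R) (a : index -> R).
Context (mg : measurable_fun [set: V] g) (g0 : forall x, 0 <= g x).
Context (a0 : forall q, 0 <= a q).
Context (carl : forall N j q, S j q ->
  tsum N (fun i s => (S i s)%:R * vol s) j q <= 2 * vol q).
Context (key : forall q l, 0 < l -> l <= a q ->
  ((vol q)%:E <= \int[mu]_(x in Q q) (Phi (g x / l))%:E)%E).

(** At a cube of S with l <= e a, the hypothesis key is used with l / e. The part
    of the integral where g <= c l is at most half of the volume, so the volume is
    at most twice the integral of trunc, and by the Carleson property the total
    volume of this cube and of the cubes of S below it is at most four times this
    integral. Elsewhere one goes down one generation, where the integrals over the
    children add up; in this way the argument reaches the maximal cubes. *)
Let level_bound (c e l : R) : 0 < c -> 0 < l -> 0 < e <= 1 -> Phi (e * c) <= 2^-1 ->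
  forall N j q,
  ((tsum N (fun i s => (S i s && (l <= e * a s)%R)%:R * vol s) j q)%:E <=
   4%:E * \int[mu]_(x in Q q) (trunc g c l x)%:E)%E.
Proof.
move=> c0 l0 /andP[e0 e1] Phic N j q.
have trunc0 s : (0 <= \int[mu]_(x in Q s) (trunc g c l x)%:E)%E.
  exact: integral_real_ge0.
have base i s : S i s -> (l <= e * a s)%R ->
    ((2 * vol s)%:E <= 4%:E * \int[mu]_(x in Q s) (trunc g c l x)%:E)%E.
  move=> _ las.
  have le0 : 0 < l / e by rewrite divr_gt0.
  have lea : l / e <= a s by rewrite ler_pdivrMr// mulrC.
  have : ((vol s)%:E <= \int[mu]_(x in Q s) (trunc g c l x)%:E + (2^-1 * vol s)%:E)%E.
    apply: le_trans (key le0 lea) _.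
    have -> : (2^-1 * vol s)%:E = (\int[mu]_(x in Q s) (2^-1)%:E)%E.
      by rewrite (integral_cst _ (mQ s)) EFinM dyadic_volumeE.
    have mt := measurable_trunc c l mg.
    rewrite -(ge0_integralD_real (mQ s) mt (measurable_cst _)); last 2 first.
    - exact: trunc_ge0.
    - by move=> x; rewrite invr_ge0.
    apply: (ge0_le_integral_real (mQ s)).
    - exact: measurable_ratio.
    - by apply: (measurable_funD mt); exact: measurable_cst.
    - by move=> x; exact: Phi0.
    move=> x _; rewrite /trunc /=.
    have -> : g x / (l / e) = e * (g x / l) by rewrite invf_div mulrCA.
    have gl : 0 <= g x / l by rewrite divr_ge0// ltW.
    case: ifPn => [_|]; last rewrite -leNgt => gc.
      rewrite ler_wpDr ?invr_ge0// Phi_nd//.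
      by rewrite -[leRHS]mul1r ler_wpM2r.
    rewrite add0r (le_trans _ Phic)// Phi_nd// ler_wpM2l ?(ltW e0)//.
    by rewrite ler_pdivrMr.
  move: (trunc0 s); case: (integral _ _ _) => [I| |]// I0.
    by rewrite -EFinD -EFinM !lee_fin; lra.
  by move=> _; rewrite gt0_muley ?leey ?lte_fin.
have full : forall N j q, S j q -> l <= e * a q ->
   ((tsum N (fun i s => (S i s && (l <= e * a s)%R)%:R * vol s) j q)%:E <=
   4%:E * \int[mu]_(x in Q q) (trunc g c l x)%:E)%E.
  move=> {}N {}j {}q Sq lq; apply: le_trans (base _ _ Sq lq).
  rewrite lee_fin; apply: le_trans (carl N Sq); apply: tsum_le => i s.
  rewrite ler_wpM2r ?dyadic_volume_ge0//.
  by rewrite ler_nat; case: (S i s) => //=; exact: leq_b1.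
elim: N j q => [|N IH] j q; have [/andP[Sq lq]|nq] := boolP (S j q && (l <= e * a q)%R);
    try exact: full; rewrite /= (negbTE nq) mul0r add0r.
  by apply: mule_ge0.
rewrite ge0_integral_children; last 2 first.
- apply: measurable_EFin_fun; exact: measurable_trunc.
- by move=> x _; rewrite lee_fin.
rewrite ge0_sume_distrr; last by move=> f _; exact: trunc0.
by rewrite -sumEFin; apply: lee_sum => f _; exact: IH.
Qed.

Lemma embedding_with_constants (c C e : R) :
  0 <= C -> 0 < c -> 0 < e <= 1 -> Phi (e * c) <= 2^-1 ->
  (forall L M y, 0 <= y -> \sum_(l < M) dyadic_height L l `^ r *
     (if c * dyadic_height L l < y then Phi (y / dyadic_height L l) else 0)
    <= C * y `^ r) ->
  forall N j q,
  ((tsum N (fun i s => (S i s)%:R * (a s `^ r * vol s)) j q)%:E <=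
   (e `^ (- r) * (2 `^ r) * 4 * C)%:E * \int[mu]_(x in Q q) (g x `^ r)%:E)%E.
Proof.
move=> C0 c0 e01 Phic tailC N j q; have /andP[e0 e1] := e01.
pose h := @dyadic_height R.
have h0 L l : 0 < h L l by exact: dyadic_height_gt0.
pose G L i s : R := (S i s)%:R * (e `^ (- r) * (2 `^ r * \sum_(l < L.*2.+1)
  (h L l <= e * a s)%R%:R * h L l `^ r) * vol s).
have [L FG] : exists L, tsum N (fun i s => (S i s)%:R * (a s `^ r * vol s)) j q
    <= tsum N (G L) j q.
  suff : \forall L \near \oo, tsum N (fun i s => (S i s)%:R * (a s `^ r * vol s)) j q
    <= tsum N (G L) j q by case=> L _ /(_ L (leqnn L)); exists L.
  apply: near_tsum_le => i s.
  have ea0 : 0 <= e * a s by rewrite mulr_ge0// ltW.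
  apply: filterS (dyadic_layers r0 ea0) => L le.
  apply: ler_wpM2l => //; apply: ler_wpM2r; first exact: dyadic_volume_ge0.
  have -> : a s `^ r = e `^ (- r) * (e * a s) `^ r.
    by rewrite powRM ?(ltW e0)// mulrA powRN mulVf ?mul1r// gt_eqF// powR_gt0.
  by apply: ler_wpM2l; first exact: powR_ge0.
apply: (@le_trans _ _ (tsum N (G L) j q)%:E); first by rewrite lee_fin.
have -> : tsum N (G L) j q = e `^ (- r) * 2 `^ r * \sum_(l < L.*2.+1) h L l `^ r *
    tsum N (fun i s => (S i s && (h L l <= e * a s)%R)%:R * vol s) j q.
  under eq_bigr do rewrite -tsumZ.
  rewrite -(tsum_sum _ _ _ (fun (l i : nat) s => h L l `^ r *
    ((S i s && (h L l <= e * a s)%R)%:R * vol s))) -tsumZ; congr (tsum N _ j q).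
  apply/funext => i; apply/funext => s; rewrite /G !mulrA mulrC !mulrA.
  rewrite [RHS]mulr_sumr.
  rewrite [LHS](_ : _ = e `^ (- r) * 2 `^ r * (vol s * (S i s)%:R) *
   \sum_(l < L.*2.+1) (h L l <= e * a s)%R%:R * h L l `^ r); last by ring.
  rewrite mulr_sumr; apply: eq_bigr => l _.
  by case: (S i s); rewrite /= ?mul0r ?mulr0 ?mul0r; ring.
have p0 : 0 <= e `^ (- r) * 2 `^ r by rewrite mulr_ge0 ?powR_ge0.
rewrite -[_ * 4 * C]mulrA [X in (_ <= X * _)%E]EFinM -muleA [X in (X <= _)%E]EFinM.
apply: lee_wpmul2l; first by rewrite lee_fin.
apply: (@le_trans _ _ (\sum_(l < L.*2.+1) (h L l `^ r)%:E *
   (4%:E * \int[mu]_(x in Q q) (trunc g c (h L l) x)%:E))%E).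
  rewrite -sumEFin; apply: lee_sum => l _; rewrite EFinM.
  by apply: lee_wpmul2l; [rewrite lee_fin powR_ge0|exact: level_bound].
rewrite EFinM -muleA.
under eq_bigr do rewrite muleCA.
rewrite -ge0_sume_distrr; last first.
  by move=> l _; apply: mule_ge0; [rewrite lee_fin powR_ge0|exact: integral_real_ge0].
apply: lee_wpmul2l; first by rewrite lee_fin.
have mt l := measurable_trunc c (h L l) mg.
under eq_bigr => l _.
  rewrite -(ge0_integralZ_real (mQ q) (mt l) (trunc_ge0 _ _ _) (powR_ge0 _ _)).
  over.
have mt' l : measurable_fun [set: V] (fun x => h L l `^ r * trunc g c (h L l) x).
  by apply: (measurable_funM _ (mt l)); exact: measurable_cst.
have t0 l x : 0 <= h L l `^ r * trunc g c (h L l) x by rewrite mulr_ge0 ?powR_ge0.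
rewrite -(ge0_integral_sum_real (mQ q) (fun l : 'I_ _ => mt' l) (fun l : 'I_ _ => t0 l)).
have mgr := measurable_powR_fun r mg.
rewrite -(ge0_integralZ_real (mQ q) mgr _ C0); last by move=> x; exact: powR_ge0.
apply: (ge0_le_integral_real (mQ q)).
- by apply: measurable_sum => l; exact: mt'.
- by apply: (measurable_funM _ mgr); exact: measurable_cst.
- by move=> x; apply: sumr_ge0 => l _; exact: t0.
by move=> x _; exact: tailC.
Qed.

End embedding.

(** The value of e in the proof makes Phi (e c) <= 1/2, where c is the point from
    which the B_r integral of Phi is finite. *)
Theorem carleson_embedding {R : realType} {n : nat} (r : R) (Phi : R -> R) :
  0 < r -> (forall t, 0 <= Phi t) -> {homo Phi : s t / s <= t} ->
  (forall e t, 0 <= e <= 1 -> 0 <= t -> Phi (e * t) <= e * Phi t) ->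
  Bcond r Phi ->
  exists2 C : R, 0 < C & forall (S : nat -> @dyadic_index n -> bool)
    (g : Rn R n -> R) (a : @dyadic_index n -> R),
  measurable_fun [set: Rn R n] g -> (forall x, 0 <= g x) -> (forall q, 0 <= a q) ->
  (forall N j q, S j q ->
    tsum (@dyadic_child n) N (fun i s => (S i s)%:R * dyadic_volume s) j q <=
    2 * dyadic_volume q :> R) ->
  (forall q l, 0 < l -> l <= a q -> ((dyadic_volume q)%:E <=
     \int[@lebesgueRn R n]_(x in dyadic_cube q) (Phi (g x / l))%:E)%E) ->
  forall N j q,
  ((tsum (@dyadic_child n) N
      (fun i s => (S i s)%:R * (a s `^ r * dyadic_volume s)) j q)%:E <=
   C%:E * \int[@lebesgueRn R n]_(x in dyadic_cube q) (g x `^ r)%:E)%E.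
Proof.
move=> r0 Phi0 Phi_nd Phi_scale BPhi.
have [c [C [c0 C0 tailC]]] := dyadic_tail_sum r0 Phi0 Phi_nd BPhi.
pose e := (2 * (Phi c + 1))^-1.
have P1 : 0 < Phi c + 1 by rewrite ltr_wpDl.
have e0 : 0 < e by rewrite invr_gt0 mulr_gt0.
have e1 : 0 < e <= 1.
  by rewrite e0/= invf_le1 ?mulr_gt0//; have := Phi0 c; lra.
exists (e `^ (- r) * 2 `^ r * 4 * C).
  by rewrite !mulr_gt0// powR_gt0.
move=> S g a mg g0 a0 carl key; have half : Phi (e * c) <= 2^-1.
  apply: le_trans (Phi_scale _ _ _ (ltW c0)) _.
    by rewrite (ltW e0); case/andP: e1.
  rewrite /e invfM -mulrA ler_piMr ?invr_ge0// mulrC ler_pdivrMr// mul1r lerDl.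
  exact: ler01.
exact: (embedding_with_constants r0 Phi0 Phi_nd mg g0 a0 carl key (ltW C0) c0
  e1 half tailC).
Qed.

(** * Luxemburg norms and bump conditions *)

Section bumps.
Context {R : realType} {n : nat}.
Local Notation V := (Rn R n).
Local Notation mu := (@lebesgueRn R n).
Local Notation index := (@dyadic_index n).
Local Notation Q := (@dyadic_cube R n).
Local Notation vol := (@dyadic_volume R n).

(** The numbers whose infimum is the Luxemburg norm. Unlike the norm, which may be
    0 or infinite, an admissible number is a positive real. *)
Definition admissible (B : R -> R) (D : set V) (w : V -> \bar R) (b : R) : Prop :=
  0 < b /\ (eaverage D (fun x => young_ext B (`|w x| * b^-1%:E)) <= 1)%E.

Lemma luxemburg_lt (B : R -> R) (D : set V) (w : V -> \bar R) (l : \bar R) :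
  (luxemburg B D w < l)%E -> exists2 b, admissible B D w b & (b%:E < l)%E.
Proof.
by move=> /ereal_inf_lt[_ [b [b0 hb] <-] bl]; exists b.
Qed.

Lemma luxemburg_ge0 (B : R -> R) (D : set V) (w : V -> \bar R) :
  (0 <= luxemburg B D w)%E.
Proof.
by apply: le_ereal_inf_tmp => _ [b [b0 _] <-]; rewrite lee_fin ltW.
Qed.

(** The associate function is constant to the left of 0 here, which makes it
    monotone, hence measurable, on the whole line. *)
Definition associate (B : R -> R) (t : R) : R := young_associate B (Num.max 0 t).

Let mQ q : measurable (Q q). Proof. exact: measurable_dyadic. Qed.

Section associate.
Context (B : R -> R) (hB : young_function B).

Lemma associate_ge0 t : 0 <= associate B t.
Proof. by rewrite young_associate_ge0// le_max lexx. Qed.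

Lemma associate_nd : {homo associate B : s t / s <= t}.
Proof.
move=> s t st; apply: young_associate_le => //; first by rewrite le_max lexx.
by rewrite ge_max le_max lexx/= le_max st orbT.
Qed.

Lemma associate_scale e t : 0 <= e <= 1 -> 0 <= t ->
  associate B (e * t) <= e * associate B t.
Proof.
move=> e01 t0; rewrite /associate !max_r// ?young_associate_scale//.
by rewrite mulr_ge0//; case/andP: e01.
Qed.

Lemma associate_Bcond r : Bcond r (young_associate B) -> Bcond r (associate B).
Proof.
move=> [c c0 Hc]; exists c => //; apply: le_lt_trans Hc.
rewrite le_eqVlt; apply/orP; left; apply/eqP; apply: eq_integral => t.
by rewrite inE/= in_itv/= andbT => ct; rewrite /associate max_r// (le_trans (ltW c0)).
Qed.

Context (v : V -> R) (s : R) (mv : measurable_fun [set: V] v).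

Let young_epow (b : R) (x : V) : \bar R :=
  young_ext B (`|epow v s x| * b^-1%:E)%E.

Let young_epowE b x : 0 < b -> young_epow b x =
  if (v x == 0) && (s < 0) then +oo%E else (B (Num.max 0 (v x `^ s / b)))%:E.
Proof.
move=> b0; rewrite /young_epow /epow; case: ifP => _.
  by rewrite gt0_mulye// lte_fin invr_gt0.
rewrite -EFinM/= ger0_norm ?powR_ge0// max_r//.
by rewrite mulr_ge0 ?powR_ge0// invr_ge0 ltW.
Qed.

Let measurable_young_epow b : 0 < b -> measurable_fun [set: V] (young_epow b).
Proof.
move=> b0; rewrite (_ : young_epow b = fun x => if (v x == 0) && (s < 0) then +oo%E
  else (B (Num.max 0 (v x `^ s / b)))%:E); last first.
  by apply/funext => x; exact: young_epowE.
apply: measurable_fun_ifT.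
- apply: measurable_and; last exact: measurable_cst.
  by apply: (measurable_fun_eqr mv); exact: measurable_cst.
- exact: measurable_cst.
- apply: measurable_EFin_fun.
  have mvs := measurable_scale_fun b^-1 (measurable_powR_fun s mv).
  apply: (@measurable_nd_fun _ _ _ _ (fun y => B (Num.max 0 y)) _ mvs) => y z yz.
  have y0 : 0 <= Num.max 0 y by rewrite le_max lexx.
  have yz' : Num.max 0 y <= Num.max 0 z.
    by rewrite ge_max le_max lexx/= le_max yz orbT.
  move: yz'; rewrite le_eqVlt => /predU1P[-> //|yz'].
  apply/ltW/(young_increasing hB) => //; rewrite in_itv/= andbT//.
  exact: le_trans (ltW yz').
Qed.

Let young_epow_ge0 b x : 0 < b -> (0 <= young_epow b x)%E.
Proof.
move=> b0; rewrite young_epowE//; case: ifP => _ //.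
by rewrite lee_fin (young_ge0 hB)// le_max lexx.
Qed.

Let integral_young_epow b q : admissible B (Q q) (epow v s) b ->
  (\int[mu]_(x in Q q) young_epow b x <= (vol q)%:E)%E.
Proof.
move=> [b0]; rewrite /eaverage -/(vol q) -/(young_epow b).
have [q0 _|q0] := eqVneq (vol q) 0.
  rewrite q0 (null_set_integral (mQ q)); first exact: lexx.
  - exact: measurable_funTS (measurable_young_epow b0).
  - exact: etrans (esym (dyadic_volumeE q)) (congr1 EFin q0).
have qp : 0 < vol q by rewrite lt_def q0 dyadic_volume_ge0.
by rewrite lee_pdivrMl// mule1.
Qed.

Lemma young_integral (phi g : V -> R) b l q :
  measurable_fun [set: V] phi -> measurable_fun [set: V] g ->
  (forall x, 0 <= phi x) -> (forall x, 0 <= g x) ->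
  (forall x, ~~ ((v x == 0) && (s < 0)) -> phi x <= g x * v x `^ s) ->
  admissible B (Q q) (epow v s) b -> 0 < l ->
  ((l * b)^-1%:E * \int[mu]_(x in Q q) (phi x)%:E <=
   \int[mu]_(x in Q q) (associate B (g x / l))%:E + (vol q)%:E)%E.
Proof.
move=> mphi mg phi0 g0 le adm l0; have [b0 _] := adm.
have lb0 : 0 <= (l * b)^-1 by rewrite invr_ge0 mulr_ge0// ltW.
apply: le_trans (leeD2l _ (integral_young_epow adm)).
have massoc : measurable_fun [set: V] (fun x => associate B (g x / l)).
  by apply: (measurable_nd_fun associate_nd); exact: measurable_scale_fun.
rewrite -(ge0_integralD _ (mQ q)); last 4 first.
- by move=> x _; rewrite lee_fin associate_ge0.
- exact: measurable_EFin_fun.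
- by move=> x _; exact: young_epow_ge0.
- exact: measurable_funTS (measurable_young_epow b0).
rewrite -(ge0_integralZ_real (mQ q) mphi phi0 lb0).
apply: ge0_le_integral; first exact: mQ.
- by move=> x _; rewrite lee_fin mulr_ge0.
- apply: measurable_EFin_fun; apply: (measurable_funM _ mphi).
  exact: measurable_cst.
- apply: emeasurable_funD; first exact: measurable_EFin_fun.
  exact: measurable_funTS (measurable_young_epow b0).
move=> x _; rewrite young_epowE//; case: ifPn => [_|/le px].
  by rewrite addey ?leey.
rewrite -EFinD lee_fin /associate.
rewrite !max_r ?divr_ge0 ?powR_ge0 ?(ltW l0) ?(ltW b0)//.
have h1 : 0 <= v x `^ s / b by rewrite divr_ge0 ?powR_ge0 ?(ltW b0).
have h2 : 0 <= g x / l by rewrite divr_ge0 ?(ltW l0).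
apply: le_trans (young_inequality hB h1 h2).
rewrite [leRHS](_ : _ = (l * b)^-1 * (g x * v x `^ s)); last first.
  by rewrite invfM; ring.
exact: ler_wpM2l.
Qed.

(** Generalized Hoelder inequality. With b in the place of the Luxemburg norm of
    v `^ s, it says that the norm of g for the associate function is at least l
    as soon as the average of phi <= g v^s is at least 2 l b. It is stated by
    means of an integral of the associate function, so that no norm of g has to
    be introduced. *)
Lemma volume_le_integral (phi g : V -> R) b l q :
  measurable_fun [set: V] phi -> measurable_fun [set: V] g ->
  (forall x, 0 <= phi x) -> (forall x, 0 <= g x) ->
  (forall x, ~~ ((v x == 0) && (s < 0)) -> phi x <= g x * v x `^ s) ->
  admissible B (Q q) (epow v s) b -> 0 < l ->
  ((2 * l * b * vol q)%:E <= \int[mu]_(x in Q q) (phi x)%:E)%E ->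
  ((vol q)%:E <= \int[mu]_(x in Q q) (associate B (g x / l))%:E)%E.
Proof.
move=> mphi mg phi0 g0 le adm l0 big; have [b0 _] := adm.
have := young_integral mphi mg phi0 g0 le adm l0.
have lb : 0 < l * b by rewrite mulr_gt0.
have lb0 : (0 <= (l * b)^-1%:E :> \bar R)%E by rewrite lee_fin invr_ge0 ltW.
move=> /(le_trans (lee_wpmul2l lb0 big)).
rewrite -EFinM (_ : 2 * l * b * vol q = l * b * (2 * vol q)); last by ring.
rewrite mulKf ?gt_eqF//.
have : (0 <= \int[mu]_(x in Q q) (associate B (g x / l))%:E)%E.
  by apply: integral_ge0 => x _; rewrite lee_fin associate_ge0.
case: (integral _ _ _) => [I| |]// I0; last by move=> _; rewrite leey.
by rewrite -EFinD !lee_fin; lra.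
Qed.

(** The integral of phi is at most a constant times b for every admissible b, by
    the preceding inequality with g = 1 and l = 1, and the admissible b have
    infimum 0. *)
Lemma luxemburg_eq0 (phi : V -> R) q :
  measurable_fun [set: V] phi -> (forall x, 0 <= phi x) ->
  (forall x, ~~ ((v x == 0) && (s < 0)) -> phi x <= v x `^ s) ->
  luxemburg B (Q q) (epow v s) = 0%E -> (\int[mu]_(x in Q q) (phi x)%:E = 0)%E.
Proof.
move=> mphi phi0 le lux0.
have I0 : (0 <= \int[mu]_(x in Q q) (phi x)%:E)%E.
  by apply: integral_ge0 => x _; rewrite lee_fin.
have bound b : admissible B (Q q) (epow v s) b ->
    (\int[mu]_(x in Q q) (phi x)%:E <= (b * (associate B 1 + 1) * vol q)%:E)%E.
  move=> adm; have [b0 _] := adm.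
  have : forall x : V, ~~ ((v x == 0) && (s < 0)) -> phi x <= (cst 1 : V -> R) x * v x `^ s.
    by move=> x /le; rewrite /= mul1r.
  move=> le1.
  have := young_integral mphi (measurable_cst _) phi0 (fun=> ler01) le1 adm ltr01.
  have -> : (\int[mu]_(x in Q q) (associate B ((cst 1 : V -> R) x / 1))%:E =
      (associate B 1 * vol q)%:E)%E.
    rewrite EFinM dyadic_volumeE -(integral_cst _ (mQ q)).
    by apply: eq_integral => x _; rewrite /= divr1.
  rewrite -EFinD mul1r lee_pdivrMl// -EFinM.
  by rewrite -mulrA mulrDl mul1r.
apply/eqP; rewrite eq_le I0 andbT; apply/lee_addgt0Pr => e e0; rewrite add0e.
have k0 : 0 < (associate B 1 + 1) * vol q + 1.
  by rewrite ltr_wpDl// mulr_ge0 ?dyadic_volume_ge0// addr_ge0// associate_ge0.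
have : (luxemburg B (Q q) (epow v s) <
    (e / ((associate B 1 + 1) * vol q + 1))%:E)%E.
  by rewrite lux0 lte_fin divr_gt0.
move=> /luxemburg_lt[b adm]; have [b0 _] := adm.
rewrite lte_fin ltr_pdivlMr// => be; apply: le_trans (bound _ adm) _.
by rewrite lee_fin -mulrA; move: be; rewrite mulrDr mulr1; lra.
Qed.

End associate.

Lemma integral_eq0_imply (phi psi : V -> R) q :
  measurable_fun [set: V] phi -> measurable_fun [set: V] psi ->
  (forall x, phi x = 0 -> psi x = 0) ->
  (forall x, 0 <= phi x) ->
  (\int[mu]_(x in Q q) (phi x)%:E = 0)%E -> (\int[mu]_(x in Q q) (psi x)%:E = 0)%E.
Proof.
move=> mphi mpsi imp phi0 int0.
have mphiQ : measurable_fun (Q q) (EFin \o phi).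
  exact: measurable_EFin_fun.
have mpsiQ : measurable_fun (Q q) (EFin \o psi).
  exact: measurable_EFin_fun.
have : ae_eq mu (Q q) (EFin \o phi) (cst 0%E).
  apply/(ae_eq_integral_abs mu (mQ q) mphiQ); rewrite -[RHS]int0.
  by apply: eq_integral => x _ /=; rewrite ger0_norm.
move=> [N [mN N0 subN]].
have aepsi : ae_eq mu (Q q) (EFin \o psi) (cst 0%E).
  exists N; split => // x /= npsi; apply: subN => /= nphi; apply: npsi => Qx.
  by have [/imp ->] := nphi Qx.
have -> : (\int[mu]_(x in Q q) (psi x)%:E = \int[mu]_(x in Q q) (cst 0 x))%E.
  apply: ae_eq_integral aepsi; [exact: mQ|exact: mpsiQ|exact: measurable_cst].
by rewrite integral0.
Qed.

Section weights.
Context (p : R) (hp : 1 < p) (u v : V -> R) (hu : weight u) (hv : weight v).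

Let p0 : 0 < p. Proof. exact: lt_trans hp. Qed.
Let u0 x : 0 <= u x. Proof. exact: hu.1. Qed.
Let v0 x : 0 <= v x. Proof. exact: hv.1. Qed.
Let mu_ : measurable_fun [set: V] u. Proof. exact: hu.2.1. Qed.
Let mv : measurable_fun [set: V] v. Proof. exact: hv.2.1. Qed.
Let lu : dyadic_integrable u. Proof. exact: locally_integrable_dyadic hu.2. Qed.

Definition weight_mass (w : V -> R) q : R := \int[mu]_(x in Q q) w x.

Lemma weight_massE q w : dyadic_integrable w ->
  (weight_mass w q)%:E = (\int[mu]_(x in Q q) (w x)%:E)%E.
Proof.
by move=> lw; rewrite fineK//; apply: integrable_fin_num => //;
  exact: lw.2.
Qed.

Lemma weight_mass_ge0 q w : (forall x, 0 <= w x) -> 0 <= weight_mass w q.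
Proof. by move=> w0; apply: Rintegral_ge0. Qed.

Lemma weight_mass_vol0 q w : dyadic_integrable w ->
  vol q = 0 -> weight_mass w q = 0.
Proof. by move=> lw q0; rewrite /weight_mass -volume_average// q0 mul0r. Qed.

(** If u has positive mass on the cube, the first factor of the bump is a positive
    number U, so the second one is less than (M + 1) / U, where M is the supremum;
    any admissible number below this bound will do. If u has no mass on the cube,
    the second factor may be infinite, but then the cube contributes nothing. *)
Lemma admissible_bumps_le2 B : young_function B ->
  (ereal_sup [set normQ p D (epow u p^-1) * luxemburg B D (epow v (- p^-1))
             | D in cubes R n] < +oo)%E ->
  exists2 K : R, 0 < K & forall q, weight_mass u q = 0 \/
    exists2 b, admissible B (Q q) (epow v (- p^-1)) b &
      weight_mass u q * b `^ p <= K * vol q.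
Proof.
move=> hB; set M := ereal_sup _ => supM.
have normE q : normQ p (Q q) (epow u p^-1) =
    (((vol q)^-1 * weight_mass u q) `^ p^-1)%:E.
  rewrite /normQ /eaverage -/(vol q) -poweR_EFin EFinM (weight_massE _ lu).
  congr (poweR (_ * _) _)%E; apply: eq_integral => x _.
  rewrite /epow ltNge invr_ge0 (ltW p0) andbF/= ger0_norm ?powR_ge0//.
  by rewrite -powRrM mulVf ?gt_eqF// powRr1.
have le r : (normQ p (Q r) (epow u p^-1) * luxemburg B (Q r) (epow v (- p^-1)) <= M)%E.
  by apply: ereal_sup_ubound; exists (Q r) => //; exact: dyadic_cube_cubes.
have M0 : (0 <= M)%E.
  apply: le_trans (le (0, 0)); rewrite normE.
  by rewrite mule_ge0 ?luxemburg_ge0// lee_fin powR_ge0.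
have [m mE] : exists m, M = m%:E by case: M supM M0 {le} => // m; exists m.
rewrite mE lee_fin in M0; exists ((m + 1) `^ p); first by apply: powR_gt0; rewrite ltr_wpDl.
move=> q; have [uq|uq] := eqVneq (weight_mass u q) 0; [by left|right].
have uq0 : 0 < weight_mass u q by rewrite lt_def uq weight_mass_ge0.
have q0 : 0 < vol q.
  rewrite lt_def dyadic_volume_ge0 andbT; apply: contra_neq uq.
  by apply: weight_mass_vol0; exact: lu.
set U := ((vol q)^-1 * weight_mass u q) `^ p^-1.
have U0 : 0 < U by rewrite powR_gt0// mulr_gt0// invr_gt0.
have : (luxemburg B (Q q) (epow v (- p^-1)) < ((m + 1) / U)%:E)%E.
  have := le q; rewrite normE -/U mE.
  case: (luxemburg _ _ _) => [l| |]; last by rewrite ltNye.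
    rewrite -EFinM lee_fin lte_fin ltr_pdivlMr// mulrC => /le_lt_trans; apply.
    by rewrite ltrDl.
  by rewrite gt0_muley ?lte_fin.
move=> /luxemburg_lt[b adm]; rewrite lte_fin ltr_pdivlMr// => bU.
exists b => //; have [b0 _] := adm.
have : (b * U) `^ p <= (m + 1) `^ p.
  by apply: ge0_ler_powR; rewrite ?nnegrE ?(ltW p0) ?(ltW bU)// ?mulr_ge0 ?ltW//; lra.
rewrite powRM ?(ltW b0) ?(ltW U0)// /U -powRrM mulVf ?gt_eqF// powRr1; last first.
  by apply: mulr_ge0; [rewrite invr_ge0|]; exact: ltW.
by rewrite mulrCA mulrC ler_pdivrMr// mulrC.
Qed.

(** Here both factors could be 0 or infinite, and 0 times infinity is 0. When u
    has positive mass, neither is 0 by [luxemburg_eq0]: applied to u^(2/p) it would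
    give a null weight, and applied to (1 + v)^(-1/p), which lies below v^(-1/p), a
    null cube. Thus both are finite, and each is within a factor 2 of an
    admissible number. *)
Lemma admissible_bumps_gt2 A B : young_function A -> young_function B ->
  (ereal_sup [set poweR (luxemburg A D (epow u (2 / p))) 2^-1
                    * luxemburg B D (epow v (- p^-1))
             | D in cubes R n] < +oo)%E ->
  exists2 K : R, 0 < K & forall q, weight_mass u q = 0 \/
    exists a b, [/\ admissible A (Q q) (epow u (2 / p)) a,
      admissible B (Q q) (epow v (- p^-1)) b & a * b ^+ 2 <= K].
Proof.
move=> hA hB; set M := ereal_sup _ => supM.
have le r : (poweR (luxemburg A (Q r) (epow u (2 / p))) 2^-1
    * luxemburg B (Q r) (epow v (- p^-1)) <= M)%E.
  by apply: ereal_sup_ubound; exists (Q r) => //; exact: dyadic_cube_cubes.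
have M0 : (0 <= M)%E.
  by apply: le_trans (le (0, 0)); rewrite mule_ge0 ?luxemburg_ge0// poweR_ge0.
have [m mE] : exists m, M = m%:E by case: M supM M0 {le} => // m; exists m.
rewrite mE lee_fin in M0; exists (8 * m ^+ 2 + 1).
  by have := sqr_ge0 m; lra.
move=> q; have [uq|uq] := eqVneq (weight_mass u q) 0; [by left|right].
have q0 : vol q != 0.
  by apply: contra_neq uq; apply: weight_mass_vol0; exact: lu.
have LA0 : luxemburg A (Q q) (epow u (2 / p)) != 0%E.
  apply: contra_neq uq => LA; apply: EFin_inj; rewrite (weight_massE _ lu).
  have mup := measurable_powR_fun (2 / p) mu_.
  have up0 x : 0 <= u x `^ (2 / p) by exact: powR_ge0.
  apply: (integral_eq0_imply mup mu_ _ up0); first by move=> x /powR_eq0_eq0.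
  exact: (luxemburg_eq0 hA mu_ mup up0 _ LA).
have LB0 : luxemburg B (Q q) (epow v (- p^-1)) != 0%E.
  apply: contra_neq q0 => LB; apply: EFin_inj.
  rewrite dyadic_volumeE -[LHS]mul1e -(integral_cst _ (mQ q)).
  have v1 x : 0 < 1 + v x by rewrite ltr_wpDr.
  have mv1 : measurable_fun [set: V] (fun x => (1 + v x) `^ (- p^-1)).
    apply: measurable_powR_fun; apply: (measurable_funD _ mv).
    exact: measurable_cst.
  have v10 x : 0 <= (1 + v x) `^ (- p^-1) by exact: powR_ge0.
  apply: (integral_eq0_imply mv1 (measurable_cst _) _ v10).
  - by move=> x /powR_eq0_eq0 h; have := v1 x; rewrite h ltxx.
  - apply: (luxemburg_eq0 hB mv mv1 v10 _ LB).
    move=> x; rewrite oppr_lt0 invr_gt0 p0 andbT => vx.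
    have vx0 : 0 < v x by rewrite lt_def vx v0.
    rewrite !powRN lef_pV2 ?posrE ?powR_gt0//.
    apply: ge0_ler_powR; rewrite ?nnegrE ?invr_ge0 ?(ltW p0) ?(ltW vx0) ?(ltW (v1 x))//.
    by rewrite lerDr.
have := le q; rewrite mE.
have := luxemburg_ge0 A (Q q) (epow u (2 / p)).
have := luxemburg_ge0 B (Q q) (epow v (- p^-1)).
case EB : (luxemburg B _ _) LB0 => [y| |] //; case EA : (luxemburg A _ _) LA0 => [x| |] //.
- rewrite !eqe !lee_fin => x0 y0 y0' x0'.
  move=> xy.
  have xp : 0 < x by rewrite lt_def x0.
  have yp : 0 < y by rewrite lt_def y0.
  have [|a adma] := @luxemburg_lt A (Q q) (epow u (2 / p)) (2 * x)%:E.
    by rewrite EA lte_fin; lra.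
  rewrite lte_fin => ax.
  have [|b admb] := @luxemburg_lt B (Q q) (epow v (- p^-1)) (2 * y)%:E.
    by rewrite EB lte_fin; lra.
  rewrite lte_fin => byy; exists a, b; split => //.
  have [a0 _] := adma; have [b0 _] := admb.
  have xy2 : x * y ^+ 2 <= m ^+ 2.
    have : (x `^ 2^-1 * y) ^+ 2 <= m ^+ 2.
      by rewrite ler_sqr ?nnegrE// mulr_ge0 ?powR_ge0 ?ltW.
    by rewrite exprMn powR12_sqrt// sqr_sqrtr.
  have b2 : b ^+ 2 <= 4 * y ^+ 2 by nra.
  have : a * b ^+ 2 <= (2 * x) * (4 * y ^+ 2).
    by apply: ler_pM => //; rewrite ?(ltW ax) ?sqr_ge0// ltW.
  by nra.
- move=> _; rewrite eqe lee_fin => y0 y0' _.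
  by rewrite poweRyr ?invr_eq0 ?pnatr_eq0// gt0_mulye// lte_fin lt_def y0.
- rewrite eqe => x0 _ _; rewrite lee_fin => x0'; rewrite poweR_EFin gt0_muley//.
  by rewrite lte_fin powR_gt0// lt_def x0.
- by move=> _ _ _ _; rewrite poweRyr ?invr_eq0 ?pnatr_eq0.
Qed.

End weights.
End bumps.

(** * Sparse domination of the square function *)

Section chains.
Context {R : realType} {n : nat}.
Local Notation V := (Rn R n).
Local Notation mu := (@lebesgueRn R n).
Local Notation index := (@dyadic_index n).
Local Notation Q := (@dyadic_cube R n).
Local Notation tsum := (tsum (@dyadic_child n)).

(** As a function of x this is the sum of F(Q) chi_Q over N + 1 generations of
    cubes, since one cube of each level contains x. *)
Definition chain_sum (N : nat) (F : nat -> index -> R) (j : nat) (k : int) (x : V) : R :=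
  \sum_(i < N.+1) F (j + i)%N (dyadic_cell (k - i%:Z) x).

Lemma chain_sum_ge0 N F j k x : (forall i r, 0 <= F i r) -> 0 <= chain_sum N F j k x.
Proof. by move=> F0; apply: sumr_ge0. Qed.

Lemma chain_sum0 F j k x : chain_sum 0 F j k x = F j (dyadic_cell k x).
Proof. by rewrite /chain_sum big_ord_recl big_ord0 addr0 addn0 subr0. Qed.

Lemma chain_sumS N F j k x :
  chain_sum N.+1 F j k x = F j (dyadic_cell k x) + chain_sum N F j.+1 (k - 1) x.
Proof.
rewrite /chain_sum big_ord_recl addn0 subr0; congr (_ + _); apply: eq_bigr => i _.
rewrite lift0 addSnnS; congr (F _ (dyadic_cell _ x)); lia.
Qed.

Lemma measurable_chain_sum N F j k : measurable_fun [set: V] (chain_sum N F j k).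
Proof.
by apply: measurable_sum => i; exact: (measurable_dyadic_cell _ (F (j + i)%N)).
Qed.

Lemma chain_sum_le_tsum N F j q x : (forall i r, 0 <= F i r) -> Q q x ->
  chain_sum N F j q.1 x <= tsum N F j q.
Proof.
move=> F0; elim: N j q => [|N IH] j q qx.
  by rewrite chain_sum0 -((dyadic_cubeE q x).1 qx) /= addr0.
rewrite chain_sumS -((dyadic_cubeE q x).1 qx) /= lerD2l.
have [e ex] := (dyadic_childP q x).1 qx.
rewrite (bigD1 e)//=; apply: (le_trans (IH j.+1 _ ex)).
by rewrite lerDl sumr_ge0// => e' _; exact: tsum_ge0.
Qed.

(** By splitting the cube into its children, one generation after the other. *)
Lemma integral_chain_sum N F j q (w : V -> R) :
  dyadic_integrable w -> (forall x, 0 <= w x) -> (forall i r, 0 <= F i r) ->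
  (\int[mu]_(x in Q q) (chain_sum N F j q.1 x * w x)%:E =
   (tsum N (fun i r => F i r * weight_mass w r) j q)%:E)%E.
Proof.
move=> lw w0 F0.
have mQ r : measurable (Q r) by exact: measurable_dyadic.
have cst k r : (\int[mu]_(x in Q r) (F k r * w x)%:E =
    (F k r * weight_mass w r)%:E)%E.
  rewrite EFinM (weight_massE _ lw); exact: (ge0_integralZ_real (mQ r) lw.1 w0 (F0 k r)).
elim: N j q => [|N IH] j q.
  rewrite /= addr0 -cst; apply: eq_integral => x; rewrite inE => qx.
  by rewrite chain_sum0 -((dyadic_cubeE q x).1 qx).
have mprod : measurable_fun [set: V] (fun x => chain_sum N F j.+1 (q.1 - 1) x * w x).
  by apply: (measurable_funM _ lw.1); exact: measurable_chain_sum.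
have prod0 x : 0 <= chain_sum N F j.+1 (q.1 - 1) x * w x.
  by apply: mulr_ge0 => //; exact: chain_sum_ge0.
have mw : measurable_fun [set: V] (fun x => F j q * w x).
  by apply: (measurable_funM _ lw.1); exact: measurable_cst.
have w0' x : 0 <= F j q * w x by exact: mulr_ge0.
transitivity (\int[mu]_(x in Q q) (F j q * w x +
    chain_sum N F j.+1 (q.1 - 1) x * w x)%:E)%E.
  apply: eq_integral => x; rewrite inE => qx.
  by rewrite chain_sumS -((dyadic_cubeE q x).1 qx) mulrDl.
rewrite (ge0_integralD_real (mQ q) mw mprod w0' prod0) cst /= EFinD.
congr (_ + _)%E; rewrite ge0_integral_children; last 2 first.
- exact: measurable_EFin_fun.
- by move=> x _; rewrite lee_fin.
rewrite -sumEFin; apply: eq_bigr => e _; exact: (IH j.+1 (dyadic_child q e)).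
Qed.

End chains.

(** Concavity: with z = x + y, each t in [0, z] satisfies t / z <= (t / z)^s. *)
Lemma powR_sum_le {R : realType} (s : R) (k : nat) (F : 'I_k -> R) :
  0 < s -> s <= 1 -> (forall i, 0 <= F i) ->
  (\sum_(i < k) F i) `^ s <= \sum_(i < k) F i `^ s.
Proof.
move=> s0 s1; elim: k F => [|k IH] F F0.
  by rewrite !big_ord0 powR0 ?gt_eqF.
rewrite !big_ord_recl; apply: le_trans (lerD (lexx _) (IH _ _)); last by move=> i; exact: F0.
have : 0 <= \sum_(i < k) F (lift ord0 i) by apply: sumr_ge0.
move: (F ord0) (F0 ord0) (\sum_(i < k) _) => x x0 y y0.
have [->|z0] := eqVneq (x + y) 0; first by rewrite powR0 ?gt_eqF// addr_ge0 ?powR_ge0.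
have zp : 0 < x + y by rewrite lt_def z0 addr_ge0.
have part t : 0 <= t -> t <= x + y -> t * (x + y)^-1 * (x + y) `^ s <= t `^ s.
  move=> t0 tz.
  have e : t = t * (x + y)^-1 * (x + y) by rewrite divfK.
  rewrite [in leRHS]e powRM ?(ltW zp) ?divr_ge0 ?(ltW zp)//.
  apply: ler_wpM2r; first exact: powR_ge0.
  have [->|tn] := eqVneq t 0; first by rewrite mul0r powR_ge0.
  rewrite -{1}[t / _]powRr1 ?divr_ge0 ?(ltW zp)//; apply: ger_powR => //.
  have tp : 0 < t by rewrite lt_def tn.
  by rewrite divr_gt0//= ler_pdivrMr// mul1r.
apply: le_trans (lerD (part _ x0 _) (part _ y0 _)); rewrite ?lerDl ?lerDr//.
by rewrite -mulrDl -mulrDl mulfV// mul1r.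
Qed.

Section local.
Context {R : realType} {n : nat}.
Local Notation V := (Rn R n).
Local Notation mu := (@lebesgueRn R n).
Local Notation index := (@dyadic_index n).
Local Notation E := {ffun 'I_n.+1 -> bool}.
Local Notation Q := (@dyadic_cube R n).
Local Notation vol := (@dyadic_volume R n).
Local Notation tsum := (tsum (@dyadic_child n)).
Local Notation parent := (@dyadic_parent n).

Definition jump (f : V -> R) (q : index) : R :=
  (average (Q q) f - average (Q (parent q)) f) ^+ 2.

(** The sum starts at level k - 1: the jump at a cube involves its parent, and
    all the cubes that occur are then contained in one cube of level k. *)
Definition truncated_square (N : nat) (f : V -> R) (k : int) (x : V) : R :=
  \sum_(i < N) jump f (dyadic_cell (k - i.+1%:Z) x).

Section family.
Context (f : V -> R) (lf : dyadic_integrable f).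
Local Notation avg := (fun q => average (Q q) (fun x => `|f x|)).
Local Notation sgn := (fun q => average (Q q) f).

Definition stopping_family (j : nat) (q : index) : bool :=
  @stopped R index E parent avg sgn j q.

Lemma average_norm_ge0 q : 0 <= avg q.
Proof. exact: le_trans (normr_average_le q lf). Qed.

Lemma stopping_carleson N j q : stopping_family j q ->
  tsum N (fun i r => (stopping_family i r)%:R * vol r) j q <= 2 * vol q.
Proof.
apply: carleson.
- exact: dyadic_childK.
- exact: children_count_ge1.
- exact: dyadic_volume_ge0.
- exact: dyadic_volume_child.
- by move=> r; apply: sum_average_children; exact: dyadic_integrable_normr.
- by move=> r; exact: sum_average_children.
- by move=> r; exact: normr_average_le.
Qed.

Definition sparse_constant : R := 64 * (#|E|%:R : R) ^+ 2 + 34.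

Lemma sparse_constant_ge0 : 0 <= sparse_constant.
Proof. by rewrite /sparse_constant addr_ge0// mulr_ge0// sqr_ge0. Qed.

Lemma sparse_domination N k x : truncated_square N f k x <=
  sparse_constant * chain_sum N
    (fun i r => (stopping_family i r)%:R * avg r ^+ 2) 0 k x.
Proof.
have cP i : parent (dyadic_cell (k - i.+1%:Z) x) = dyadic_cell (k - i%:Z) x.
  by rewrite dyadic_parent_cell; congr (dyadic_cell _ x); lia.
have := @pointwise_domination R index E parent avg sgn
  (fun r => normr_average_le r lf) (fun i => dyadic_cell (k - i%:Z) x) N cP.
congr (_ <= _ * _).
by apply: eq_bigr => i _; rewrite /jump cP.
Qed.

Lemma truncated_square_ge0 N k x : 0 <= truncated_square N f k x.
Proof. by apply: sumr_ge0 => i _; exact: sqr_ge0. Qed.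

Lemma measurable_truncated_square N k :
  measurable_fun [set: V] (truncated_square N f k).
Proof. by apply: measurable_sum => i; exact: (measurable_dyadic_cell _ (jump f)). Qed.

End family.
End local.

(** * Weighted estimates on a cube *)

Section local_estimates.
Context {R : realType} {n : nat}.
Local Notation V := (Rn R n).
Local Notation mu := (@lebesgueRn R n).
Local Notation index := (@dyadic_index n).
Local Notation Q := (@dyadic_cube R n).
Local Notation vol := (@dyadic_volume R n).
Local Notation tsum := (tsum (@dyadic_child n)).

Let mQ q : measurable (Q q). Proof. exact: measurable_dyadic. Qed.

Definition carleson_family (S : nat -> index -> bool) : Prop :=
  forall N j q, S j q ->
    tsum N (fun i r => (S i r)%:R * vol r) j q <= 2 * vol q.

(** The Carleson embedding for the numbers avg(phi) / (2 b): they have the required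
    property by [volume_le_integral]. The cubes on which the weight u has no mass
    may have no admissible number; they are the ones that are not good. *)
Lemma bump_embedding (B : R -> R) (r : R) :
  young_function B -> 0 < r -> Bcond r (young_associate B) ->
  exists2 C : R, 0 < C & forall (S : nat -> index -> bool) (v phi g : V -> R)
    (s : R) (good : index -> bool) (b : index -> R),
  carleson_family S ->
  measurable_fun [set: V] v ->
  dyadic_integrable phi -> (forall x, 0 <= phi x) ->
  measurable_fun [set: V] g -> (forall x, 0 <= g x) ->
  (forall x, ~~ ((v x == 0) && (s < 0)) -> phi x <= g x * v x `^ s) ->
  (forall q, good q -> admissible B (Q q) (epow v s) (b q)) ->
  forall N j q,
  ((tsum N (fun i t => (S i t)%:R * ((if good t then average (Q t) phi / (2 * b t)
      else 0) `^ r * vol t)) j q)%:E <=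
   C%:E * \int[mu]_(x in Q q) (g x `^ r)%:E)%E.
Proof.
move=> hB r0 BB.
have [C C0 H] := @carleson_embedding R n r (associate B) r0 (associate_ge0 hB)
  (associate_nd hB) (associate_scale hB) (associate_Bcond BB).
exists C => // S v phi g s good b carl mv lphi phi0 mg g0 le adm N j q.
apply: (H S g (fun t => if good t then average (Q t) phi / (2 * b t) else 0) mg g0).
- move=> t; case: ifP => // gt; have [b0 _] := adm t gt.
  apply: divr_ge0; last by rewrite mulr_ge0// ltW.
  by apply: mulr_ge0; [rewrite invr_ge0 fine_ge0|exact: Rintegral_ge0].
- exact: carl.
- move=> t l l0; case: ifP => [gt|_]; last by rewrite leNgt l0.
  have [b0 _] := adm t gt; rewrite ler_pdivlMr ?mulr_gt0// => lt.
  apply: (volume_le_integral hB mv lphi.1 mg phi0 g0 le (adm t gt) l0).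
  rewrite -(weight_massE _ lphi) lee_fin /weight_mass -(volume_average _ lphi).
  rewrite mulrC; apply: ler_wpM2l; first exact: dyadic_volume_ge0.
  by apply: le_trans lt; rewrite mulrCA mulrA.
Qed.

Section weights.
Context (p : R) (hp : 1 < p) (u v : V -> R) (hu : weight u) (hv : weight v).

Let p0 : 0 < p. Proof. exact: lt_trans hp. Qed.
Let u0 x : 0 <= u x. Proof. exact: hu.1. Qed.
Let v0 x : 0 <= v x. Proof. exact: hv.1. Qed.
Let mw : measurable_fun [set: V] u. Proof. exact: hu.2.1. Qed.
Let mv : measurable_fun [set: V] v. Proof. exact: hv.2.1. Qed.
Let lu : dyadic_integrable u. Proof. exact: locally_integrable_dyadic hu.2. Qed.

Section function.
Context (f : V -> R) (lf : dyadic_integrable f).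
Local Notation avg q := (average (Q q) (fun x => `|f x|)).
Local Notation S := (stopping_family f).

Let labsf : dyadic_integrable (fun x => `|f x|).
Proof. exact: dyadic_integrable_normr. Qed.

(** The function |f| v^(1/p), whose p-th power integrates to the p-th power of the
    norm of f in L^p(v). *)
Definition dual_weighted (x : V) : R := `|f x| * v x `^ p^-1.

Lemma measurable_dual_weighted : measurable_fun [set: V] dual_weighted.
Proof. by apply: (measurable_funM labsf.1); exact: measurable_powR_fun. Qed.

Lemma dual_weighted_ge0 x : 0 <= dual_weighted x.
Proof. by rewrite mulr_ge0// powR_ge0. Qed.

Lemma dual_weighted_factor x : ~~ ((v x == 0) && (- p^-1 < 0)) ->
  `|f x| <= dual_weighted x * v x `^ (- p^-1).
Proof.
rewrite oppr_lt0 invr_gt0 p0 andbT => vx.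
by rewrite powRN mulfK// powR_eq0 (negbTE vx).
Qed.

Lemma dual_weighted_powR x : dual_weighted x `^ p = `|f x| `^ p * v x.
Proof.
by rewrite powRM ?powR_ge0// -powRrM mulVf ?gt_eqF// powRr1.
Qed.

Lemma stopping_family_carleson : carleson_family S.
Proof. by move=> N j q; exact: stopping_carleson. Qed.

End function.

Lemma choose_bump (T : Type) (t0 : T) (P : index -> T -> Prop) :
  (forall q, weight_mass u q = 0 \/ exists b, P q b) ->
  exists b : index -> T, forall q, weight_mass u q != 0 -> P q (b q).
Proof.
move=> H; have /choice[b Hb] : forall q, exists b, weight_mass u q != 0 -> P q b.
  move=> q; have [->|[b Pb]] := H q; first by exists t0; rewrite eqxx.
  by exists b.
by exists b.
Qed.

(** Since p / 2 <= 1, the power p / 2 of a sum is at most the sum of the powers, and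
    the estimate reduces to one for each stopping cube. *)
Lemma local_estimate_le2 (B : R -> R) : p <= 2 ->
  young_function B -> Bcond p (young_associate B) ->
  (ereal_sup [set normQ p D (epow u p^-1) * luxemburg B D (epow v (- p^-1))
             | D in cubes R n] < +oo)%E ->
  exists2 C : R, 0 < C & forall f, dyadic_integrable f -> forall N q,
   (\int[mu]_(x in Q q) (truncated_square N f q.1 x `^ (p / 2) * u x)%:E <=
    C%:E * \int[mu]_(x in Q q) (`|f x| `^ p * v x)%:E)%E.
Proof.
move=> p2 hB BB supB.
have [K K0 HK] := admissible_bumps_le2 hp hu hB supB.
have [b Hb] : exists b : index -> R, forall q, weight_mass u q != 0 ->
    admissible B (Q q) (epow v (- p^-1)) (b q) /\
    weight_mass u q * b q `^ p <= K * vol q.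
  apply: (@choose_bump _ 0 (fun q b => admissible B (Q q) (epow v (- p^-1)) b /\
    weight_mass u q * b `^ p <= K * vol q)) => q.
  have [->|[b adm le]] := HK q; first by left.
  by right; exists b.
have [C C0 HC] := bump_embedding hB p0 BB.
pose c0 := @sparse_constant R n `^ (p / 2).
have p20 : 0 < p / 2 by rewrite divr_gt0.
have c00 : 0 <= c0 by exact: powR_ge0.
exists (c0 * (2 `^ p * K) * C + 1); first by rewrite ltr_wpDl// !mulr_ge0 ?powR_ge0// ltW.
move=> f lf N q.
pose avg t := average (Q t) (fun x => `|f x|).
have avg0 t : 0 <= avg t by exact: average_norm_ge0.
pose F i t : R := (stopping_family f i t)%:R * avg t `^ p.
have F0 i t : 0 <= F i t by rewrite mulr_ge0// powR_ge0.
have mF := measurable_chain_sum N F 0 q.1.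
pose a t := if weight_mass u t != 0 then avg t / (2 * b t) else 0.
pose Y := (\int[mu]_(x in Q q) (`|f x| `^ p * v x)%:E)%E.
have Y0 : (0 <= Y)%E by apply: integral_real_ge0 => x; rewrite mulr_ge0 ?powR_ge0.
have step1 : (\int[mu]_(x in Q q) (truncated_square N f q.1 x `^ (p / 2) * u x)%:E <=
    c0%:E * \int[mu]_(x in Q q) (chain_sum N F 0 q.1 x * u x)%:E)%E.
  have mFu := measurable_funM mF mw.
  have Fu0 x : 0 <= (chain_sum N F 0 q.1 \* u) x.
    by apply: mulr_ge0 => //; exact: chain_sum_ge0.
  rewrite -(ge0_integralZ_real (mQ q) mFu Fu0 c00).
  apply: (ge0_le_integral_real (mQ q)).
  - apply: (measurable_funM _ mw); apply: measurable_powR_fun.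
    exact: measurable_truncated_square.
  - by apply: (measurable_funM _ mFu); exact: measurable_cst.
  - by move=> x; rewrite mulr_ge0 ?powR_ge0.
  move=> x _; rewrite /= mulrA; apply: ler_wpM2r => //.
  have G0 i t : 0 <= (stopping_family f i t)%:R * avg t ^+ 2 by rewrite mulr_ge0 ?sqr_ge0.
  have H0 := chain_sum_ge0 N 0 q.1 x G0.
  apply: (@le_trans _ _ ((@sparse_constant R n * chain_sum N
     (fun i t => (stopping_family f i t)%:R * avg t ^+ 2) 0 q.1 x) `^ (p / 2))).
    apply: ge0_ler_powR; rewrite ?nnegrE ?(ltW p20) ?truncated_square_ge0//.
      by rewrite mulr_ge0// sparse_constant_ge0.
    exact: sparse_domination.
  rewrite powRM ?sparse_constant_ge0//; apply: ler_wpM2l => //.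
  apply: le_trans (powR_sum_le p20 _ _) _; first by rewrite ler_pdivrMr// mul1r.
    by move=> i; exact: G0.
  apply: ler_sum => i _; rewrite /F powRM ?sqr_ge0//.
  rewrite -(powR_mulrn 2)// -powRrM [2 * _]mulrC divfK ?pnatr_eq0//.
  case: (stopping_family _ _ _); first by rewrite powR1.
  by rewrite powR0 ?gt_eqF.
have step2 : (\int[mu]_(x in Q q) (chain_sum N F 0 q.1 x * u x)%:E <=
   (2 `^ p * K)%:E * (C%:E * Y))%E.
  rewrite (integral_chain_sum N 0 q lu u0 F0).
  have adm t : weight_mass u t != 0 -> admissible B (Q t) (epow v (- p^-1)) (b t).
    by move=> /Hb[].
  have := HC _ v (fun x => `|f x|) (dual_weighted f) (- p^-1) _ b
    (stopping_family_carleson lf) mv (dyadic_integrable_normr lf)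
    (fun x => normr_ge0 _) (measurable_dual_weighted lf) (dual_weighted_ge0 f)
    (@dual_weighted_factor f) adm N 0 q.
  have -> : (\int[mu]_(x in Q q) (dual_weighted f x `^ p)%:E = Y)%E.
    by apply: eq_integral => x _; rewrite dual_weighted_powR.
  have k0 : (0 <= (2 `^ p * K)%:E :> \bar R)%E by rewrite lee_fin mulr_ge0 ?powR_ge0// ltW.
  move=> /(lee_wpmul2l k0); apply: le_trans.
  rewrite -EFinM lee_fin -tsumZ; apply: tsum_le => i t.
  rewrite /F; case: (stopping_family f i t); last by rewrite !mul0r mulr0.
  rewrite !mul1r; have [->|ut] := eqVneq (weight_mass u t) 0.
    by rewrite mulr0 !mulr_ge0 ?powR_ge0 ?dyadic_volume_ge0// ltW.
  have [[b0 _] Ht] := Hb t ut.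
  rewrite -/(avg t); set z := avg t / (2 * b t).
  have z0 : 0 <= z by rewrite divr_ge0// mulr_ge0// ltW.
  have -> : avg t `^ p = 2 `^ p * b t `^ p * z `^ p.
    have e : avg t = 2 * b t * z by rewrite mulrC divfK// mulf_neq0// gt_eqF.
    have b20 : 0 <= 2 * b t by rewrite mulr_ge0// ltW.
    by rewrite {1}e (powRM _ b20 z0) (powRM _ _ (ltW b0)).
  rewrite [leRHS](_ : _ = 2 `^ p * z `^ p * (K * vol t)); last by ring.
  rewrite [leLHS](_ : _ = 2 `^ p * z `^ p * (weight_mass u t * b t `^ p)); last by ring.
  by apply: ler_wpM2l => //; rewrite mulr_ge0 ?powR_ge0.
apply: (le_trans step1).
apply: (le_trans (lee_wpmul2l (_ : (0 <= c0%:E)%E) step2)); first by rewrite lee_fin.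
rewrite muleA muleA -!EFinM; apply: lee_wpmul2r => //.
by rewrite lee_fin lerDl.
Qed.

(** Young's inequality for (x / d) (d y). The free parameter d is used to make the
    coefficient of the second term small. *)
Lemma young_split (s t d x y : R) : 1 < s -> t = conj_exponent s -> 0 < d ->
  0 <= x -> 0 <= y -> x * y <= d `^ (- s) * x `^ s + d `^ t * y `^ t.
Proof.
move=> s1 -> d0 x0 y0.
have s0 : 0 < s by lra.
have s10 : 0 < s - 1 by lra.
have t0 : 0 < conj_exponent s by rewrite divr_gt0.
have st : s^-1 + (conj_exponent s)^-1 = 1.
  by rewrite /conj_exponent invf_div -{1}(div1r s) -mulrDl subrKC divff// gt_eqF.
have xd0 : 0 <= d^-1 * x by rewrite mulr_ge0 ?invr_ge0// ltW.
have yd0 : 0 <= d * y by rewrite mulr_ge0// ltW.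
have := conjugate_powR xd0 yd0 s0 t0 st.
rewrite mulrACA mulVf ?gt_eqF// mul1r.
have -> : (d^-1 * x) `^ s = d `^ (- s) * x `^ s.
  rewrite powRM ?invr_ge0 ?(ltW d0)//; congr (_ * _).
  by rewrite powRN -powR_inv1 ?(ltW d0)// -powRrM mulN1r powRN.
have -> : (d * y) `^ conj_exponent s = d `^ conj_exponent s * y `^ conj_exponent s.
  by rewrite powRM ?(ltW d0).
move=> /le_trans; apply.
have le1 (z r : R) : 0 <= z -> 0 < r -> r^-1 <= 1 -> z / r <= z.
  by move=> z0 r0 r1; rewrite ler_piMr.
apply: lerD; apply: le1 => //; rewrite ?mulr_ge0 ?powR_ge0//.
- by rewrite -st lerDl invr_ge0 ltW.
- by rewrite -st lerDr invr_ge0 ltW.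
Qed.

Lemma absorb (X Y : \bar R) (k : R) : (X < +oo)%E -> (0 <= X)%E ->
  (X <= k%:E * Y + (2^-1)%:E * X)%E -> (X <= (2 * k)%:E * Y)%E.
Proof.
case: X => [x| |]// _ x0; case: Y => [y| |].
- by rewrite -!EFinM -EFinD !lee_fin; lra.
- have [k0|k0|<-] := ltgtP 0 k.
  + by rewrite !gt0_muley ?lte_fin ?mulr_gt0// leey.
  + by rewrite lt0_muley ?lte_fin.
  + by rewrite !mul0e mulr0 mul0e add0e -EFinM !lee_fin; lra.
- have [k0|k0|<-] := ltgtP 0 k.
  + by rewrite gt0_muleNy ?lte_fin.
  + by rewrite !lt0_muleNy ?lte_fin ?leey// nmulr_llt0.
  + by rewrite !mul0e mulr0 mul0e add0e -EFinM !lee_fin; lra.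
Qed.

(** Duality with h = H^(s - 1), the extremal function for H in L^s(u), s = p / 2: the
    integral X of H^s u appears on both sides, and it is finite because only
    finitely many cubes are involved. *)
Lemma local_estimate_gt2 (A B : R -> R) : 2 < p ->
  young_function A -> young_function B ->
  Bcond (conj_exponent (p / 2)) (young_associate A) ->
  Bcond p (young_associate B) ->
  (ereal_sup [set poweR (luxemburg A D (epow u (2 / p))) 2^-1
                    * luxemburg B D (epow v (- p^-1))
             | D in cubes R n] < +oo)%E ->
  exists2 C : R, 0 < C & forall f, dyadic_integrable f -> forall N q,
   (\int[mu]_(x in Q q) (truncated_square N f q.1 x `^ (p / 2) * u x)%:E <=
    C%:E * \int[mu]_(x in Q q) (`|f x| `^ p * v x)%:E)%E.
Proof.
move=> p2 hA hB BA BB supB.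
pose s := p / 2; pose s' := conj_exponent s.
have s1 : 1 < s by rewrite /s; lra.
have s0 : 0 < s by lra.
have s10 : 0 < s - 1 by lra.
have s'0 : 0 < s' by rewrite divr_gt0.
have ss' : (s - 1) * s' = s by rewrite /s' /conj_exponent mulrCA divff ?mulr1// gt_eqF.
have [K K0 HK] := admissible_bumps_gt2 hp hu hv hA hB supB.
have [ab Hab] : exists ab : index -> R * R, forall q, weight_mass u q != 0 ->
    [/\ admissible A (Q q) (epow u (2 / p)) (ab q).1,
        admissible B (Q q) (epow v (- p^-1)) (ab q).2 &
        (ab q).1 * (ab q).2 ^+ 2 <= K].
  apply: (@choose_bump _ (0, 0) (fun q ab => [/\ admissible A (Q q) (epow u (2 / p)) ab.1,
        admissible B (Q q) (epow v (- p^-1)) ab.2 & ab.1 * ab.2 ^+ 2 <= K])) => q.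
  have [->|[a [b [h1 h2 h3]]]] := HK q; first by left.
  by right; exists (a, b).
have [CA CA0 HA] := bump_embedding hA s'0 BA.
have [CB CB0 HB] := bump_embedding hB p0 BB.
pose k := 8 * K; have k0 : 0 < k by rewrite mulr_gt0.
(* With this d the term that contains X on the right-hand side is X / 2. *)
pose d := (2 * k * CA) `^ (- s'^-1).
have kCA : 0 < 2 * k * CA by rewrite !mulr_gt0.
have d0 : 0 < d by rewrite powR_gt0.
have dE : k * d `^ s' * CA = 2^-1.
  rewrite /d -powRrM mulNr mulVf ?gt_eqF// powR_inv1 ?(ltW kCA)//.
  by field; rewrite !gt_eqF.
pose c0 := @sparse_constant R n `^ s.
have c00 : 0 <= c0 by exact: powR_ge0.
exists (c0 * (2 * (k * d `^ (- s) * CB)) + 1).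
  by rewrite ltr_wpDl// !mulr_ge0 ?powR_ge0// ltW.
move=> f lf N q.
pose avg t := average (Q t) (fun x => `|f x|).
have avg0 t : 0 <= avg t by exact: average_norm_ge0.
pose F i t : R := (stopping_family f i t)%:R * avg t ^+ 2.
have F0 i t : 0 <= F i t by rewrite mulr_ge0 ?sqr_ge0.
pose H := chain_sum N F 0 q.1.
have mH : measurable_fun [set: V] H := measurable_chain_sum N F 0 q.1.
have H0 x : 0 <= H x by exact: chain_sum_ge0.
pose M := tsum N F 0 q.
have HM x : Q q x -> H x <= M by exact: chain_sum_le_tsum.
pose Y := (\int[mu]_(x in Q q) (`|f x| `^ p * v x)%:E)%E.
have Y0 : (0 <= Y)%E by apply: integral_real_ge0 => x; rewrite mulr_ge0 ?powR_ge0.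
pose X := (\int[mu]_(x in Q q) (H x `^ s * u x)%:E)%E.
have mHs := measurable_powR_fun s mH.
have mHu : measurable_fun [set: V] (fun x => H x `^ s * u x) := measurable_funM mHs mw.
have Hu0 x : 0 <= H x `^ s * u x by rewrite mulr_ge0 ?powR_ge0.
have X0 : (0 <= X)%E by exact: integral_real_ge0.
have M0 : 0 <= M by exact: tsum_ge0.
have Xoo : (X < +oo)%E.
  apply: (@le_lt_trans _ _ ((M `^ s)%:E * \int[mu]_(x in Q q) (u x)%:E)%E).
    rewrite -(ge0_integralZ_real (mQ q) mw u0 (powR_ge0 M s)).
    apply: (ge0_le_integral_real (mQ q) mHu _ Hu0).
      by apply: (measurable_funM _ mw); exact: measurable_cst.
    move=> x qx; apply: ler_wpM2r => //.
    by apply: ge0_ler_powR; rewrite ?nnegrE ?(ltW s0)// HM.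
  by rewrite -(weight_massE _ lu) -EFinM ltry.
(* The indicator makes h bounded on the whole space. *)
pose h (x : V) : R := \1_(Q q) x * H x `^ (s - 1).
have h0 x : 0 <= h x by rewrite mulr_ge0 ?powR_ge0.
have hE x : Q q x -> h x = H x `^ (s - 1).
  by move=> qx; rewrite /h indicE mem_set// mul1r.
have mh : measurable_fun [set: V] h.
  apply: measurable_funM; last exact: measurable_powR_fun.
  exact: measurable_indic (mQ q).
have hM x : h x <= M `^ (s - 1).
  rewrite /h indicE; have [qx|qx] := boolP (x \in Q q); last by rewrite mul0r powR_ge0.
  rewrite mul1r; apply: ge0_ler_powR; rewrite ?nnegrE ?(ltW s10)//.
  by apply: HM; exact: set_mem.
pose w x := h x * u x.
have w0 x : 0 <= w x by rewrite mulr_ge0.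
have mwh : measurable_fun [set: V] w by exact: measurable_funM.
have lw : dyadic_integrable w.
  split=> // t.
  have intMu := integrableZl (mQ t) (M `^ (s - 1)) (lu.2 t).
  apply: (le_integrable (mQ t) _ _ intMu); first exact: measurable_EFin_fun.
  move=> x _; rewrite /= lee_fin !ger0_norm ?mulr_ge0 ?powR_ge0//.
  exact: ler_wpM2r.
pose a t := if weight_mass u t != 0 then avg t / (2 * (ab t).2) else 0.
pose a' t := if weight_mass u t != 0 then average (Q t) w / (2 * (ab t).1) else 0.
pose S i t : R := (stopping_family f i t)%:R.
have XE : X = (tsum N (fun i t => F i t * weight_mass w t) 0 q)%:E.
  rewrite -(integral_chain_sum N 0 q lw w0 F0); apply: eq_integral => x.
  rewrite inE => qx; rewrite /w (hE _ qx) mulrA -/(H x).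
  by rewrite mulr_powRB1.
have embB : ((tsum N (fun i t => S i t * (a t `^ p * vol t)) 0 q)%:E <= CB%:E * Y)%E.
  have adm t : weight_mass u t != 0 -> admissible B (Q t) (epow v (- p^-1)) (ab t).2.
    by move=> /Hab[].
  have := HB _ v (fun x => `|f x|) (dual_weighted f) (- p^-1) _ (fun t => (ab t).2)
    (stopping_family_carleson lf) mv (dyadic_integrable_normr lf)
    (fun x => normr_ge0 _) (measurable_dual_weighted lf) (dual_weighted_ge0 f)
    (@dual_weighted_factor f) adm N 0 q.
  have -> // : (\int[mu]_(x in Q q) (dual_weighted f x `^ p)%:E = Y)%E.
  by apply: eq_integral => x _; rewrite dual_weighted_powR.
pose g x := h x * u x `^ (1 - 2 / p).
have embA : ((tsum N (fun i t => S i t * (a' t `^ s' * vol t)) 0 q)%:E <= CA%:E * X)%E.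
  have adm t : weight_mass u t != 0 -> admissible A (Q t) (epow u (2 / p)) (ab t).1.
    by move=> /Hab[].
  have mg : measurable_fun [set: V] g.
    by apply: (measurable_funM mh); exact: measurable_powR_fun.
  have g0 x : 0 <= g x by rewrite mulr_ge0 ?powR_ge0.
  have fac x : ~~ ((u x == 0) && (2 / p < 0)) -> w x <= g x * u x `^ (2 / p).
    move=> _; rewrite /w /g -mulrA; apply: ler_wpM2l => //.
    by rewrite -powRD ?subrK ?powRr1// oner_eq0.
  have := HA _ u w g (2 / p) _ (fun t => (ab t).1)
    (stopping_family_carleson lf) mw lw w0 mg g0 fac adm N 0 q.
  have -> // : (\int[mu]_(x in Q q) (g x `^ s')%:E = X)%E.
  apply: eq_integral => x; rewrite inE => qx; congr EFin.
  rewrite /g (hE _ qx) powRM ?powR_ge0// -!powRrM ss'; congr (_ * _).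
  have -> : (1 - 2 / p) * s' = 1; last by rewrite powRr1.
  rewrite /s' /conj_exponent /s; field.
  by rewrite !gt_eqF//; lra.
have main : (X <= (k * d `^ (- s) * CB)%:E * Y + (2^-1)%:E * X)%E.
  have k1 : (0 <= (k * d `^ (- s))%:E :> \bar R)%E by rewrite lee_fin mulr_ge0 ?powR_ge0// ltW.
  have k2 : (0 <= (k * d `^ s')%:E :> \bar R)%E by rewrite lee_fin mulr_ge0 ?powR_ge0// ltW.
  have := leeD (lee_wpmul2l k1 embB) (lee_wpmul2l k2 embA).
  rewrite !muleA -!EFinM dE -EFinD -!tsumZ -tsumD; apply: le_trans.
  rewrite XE lee_fin; apply: tsum_le => i t; rewrite /F /S.
  case: (stopping_family f i t); last by rewrite !mul0r !mulr0 addr0.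
  rewrite !mul1r /a /a'; have [ut|ut] := eqVneq (weight_mass u t) 0.
    have -> : weight_mass w t = 0.
      apply: EFin_inj; rewrite (weight_massE _ lw).
      apply: (integral_eq0_imply mw mwh _ u0); first by move=> x ux; rewrite /w ux mulr0.
      by rewrite -(weight_massE _ lu) ut.
    rewrite mulr0 addr_ge0// mulr_ge0 ?mulr_ge0 ?powR_ge0 ?dyadic_volume_ge0//; exact: ltW.
  have [[a0 _] [b0 _] abK] := Hab t ut.
  set y := avg t / _; set z := average _ _ / _.
  have y0 : 0 <= y by rewrite divr_ge0// mulr_ge0// ltW.
  have z0 : 0 <= z.
    apply: divr_ge0; last by rewrite mulr_ge0// ltW.
    by apply: mulr_ge0; [rewrite invr_ge0 fine_ge0|exact: Rintegral_ge0].
  have yE : avg t = 2 * (ab t).2 * y by rewrite mulrC divfK// mulf_neq0// gt_eqF.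
  have zE : average (Q t) w = 2 * (ab t).1 * z by rewrite mulrC divfK// mulf_neq0// gt_eqF.
  rewrite yE /weight_mass -(volume_average _ lw) zE.
  have := young_split s1 (erefl s') d0 (sqr_ge0 y) z0.
  have -> : (y ^+ 2) `^ s = y `^ p.
    by rewrite -(powR_mulrn 2)// -powRrM mulrC divfK ?pnatr_eq0.
  move: (d `^ (- s)) (powR_ge0 d (- s)) (d `^ s') => d1 d10 d2.
  move=> split.
  have kv : 0 <= k * vol t by rewrite mulr_ge0 ?dyadic_volume_ge0// ltW.
  have yz0 : 0 <= y ^+ 2 * z by rewrite mulr_ge0 ?sqr_ge0.
  apply: (@le_trans _ _ (k * vol t * (y ^+ 2 * z))).
    rewrite [leLHS](_ : _ = 8 * ((ab t).1 * (ab t).2 ^+ 2) * (vol t * (y ^+ 2 * z))); last by ring.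
    rewrite [leRHS](_ : _ = 8 * K * (vol t * (y ^+ 2 * z))); last by rewrite /k; ring.
    apply: ler_wpM2r; first by rewrite mulr_ge0 ?dyadic_volume_ge0.
    by apply: ler_wpM2l abK; exact: ler0n.
  apply: (le_trans (ler_wpM2l kv split)).
  by rewrite le_eqVlt; apply/orP; left; apply/eqP; ring.
have step1 : (\int[mu]_(x in Q q) (truncated_square N f q.1 x `^ s * u x)%:E <=
    c0%:E * X)%E.
  rewrite -(ge0_integralZ_real (mQ q) mHu Hu0 c00).
  apply: (ge0_le_integral_real (mQ q)).
  - apply: (measurable_funM _ mw); apply: measurable_powR_fun.
    exact: measurable_truncated_square.
  - by apply: (measurable_funM _ mHu); exact: measurable_cst.
  - by move=> x; rewrite mulr_ge0 ?powR_ge0.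
  move=> x _; rewrite mulrA; apply: ler_wpM2r => //.
  rewrite -powRM ?sparse_constant_ge0//.
  apply: ge0_ler_powR; rewrite ?nnegrE ?(ltW s0) ?truncated_square_ge0//.
    by rewrite mulr_ge0// sparse_constant_ge0.
  exact: sparse_domination.
apply: (le_trans step1).
have c0e : (0 <= c0%:E :> \bar R)%E by rewrite lee_fin.
apply: (le_trans (lee_wpmul2l c0e (absorb Xoo X0 main))).
rewrite muleA -EFinM; apply: lee_wpmul2r => //.
by rewrite lee_fin lerDl.
Qed.

End weights.
End local_estimates.

(** * From cubes to the whole space *)

Section monotone_limit.
Context d (T : measurableType d) (R : realType) (m : {measure set T -> \bar R}).

(** Monotone convergence; the power of a supremum is the supremum of the powers. *)
Lemma integral_poweR_sup_le (G : nat -> T -> R) (e : T -> \bar R) (u : T -> R)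
    (s : R) (c : \bar R) :
  0 < s -> measurable_fun setT u -> (forall x, 0 <= u x) ->
  (forall M, measurable_fun setT (G M)) -> (forall M x, 0 <= G M x) ->
  (forall x, nondecreasing_seq (G ^~ x)) ->
  (forall x, e x = ereal_sup (range (fun M => (G M x)%:E))) ->
  (forall M, \int[m]_x (G M x `^ s * u x)%:E <= c)%E ->
  (\int[m]_x (poweR (e x) s * (u x)%:E) <= c)%E.
Proof.
move=> s0 mu_ u0 mG G0 ndG eE bound.
pose g M x := (G M x `^ s * u x)%:E.
have g0 M x : (0 <= g M x)%E by rewrite lee_fin mulr_ge0 ?powR_ge0.
have ndg x : nondecreasing_seq (g ^~ x).
  move=> M N MN; rewrite lee_fin; apply: ler_wpM2r => //.
  by apply: ge0_ler_powR; rewrite ?nnegrE ?(ltW s0)//; exact: ndG.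
have mg M : measurable_fun setT (g M).
  apply: measurable_EFin_fun; apply: measurable_funM => //.
  exact: measurable_powR_fun.
have limE x : (poweR (e x) s * (u x)%:E = limn (g ^~ x))%E.
  rewrite (cvg_lim _ (ereal_nondecreasing_cvgn (ndg x)))//.
  have Ge M : ((G M x)%:E <= e x)%E.
    by rewrite eE; apply: ereal_sup_ubound; exists M.
  have e0 : (0 <= e x)%E by apply: le_trans (Ge 0%N); rewrite lee_fin.
  apply/eqP; rewrite eq_le; apply/andP; split; last first.
    apply: ge_ereal_sup => _ [M _ <-]; rewrite /g EFinM -poweR_EFin.
    apply: lee_wpmul2r; first by rewrite lee_fin.
    by apply: gt0_ler_poweR; rewrite ?(ltW s0)// in_itv/= ?lee_fin ?leey ?G0 ?e0.
  have gL M : (g M x <= ereal_sup (range (g ^~ x)))%E.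
    by apply: ereal_sup_ubound; exists M.
  have [->|ux] := eqVneq (u x) 0; first by rewrite mule0 (le_trans (g0 0%N x)).
  have up : 0 < u x by rewrite lt_def ux u0.
  case: (ereal_sup _) gL => [L| |] gL; last 2 first.
  - by rewrite leey.
  - by have := le_trans (g0 0%N x) (gL 0%N).
  have L0 : 0 <= L by have := le_trans (g0 0%N x) (gL 0%N); rewrite lee_fin.
  have Lu : 0 <= L / u x by rewrite divr_ge0.
  have eL : (e x <= ((L / u x) `^ s^-1)%:E)%E.
    rewrite eE; apply: ge_ereal_sup => _ [M _ <-]; rewrite lee_fin.
    have := gL M; rewrite lee_fin -ler_pdivlMr// => GL.
    have -> : G M x = (G M x `^ s) `^ s^-1 by rewrite -powRrM divff ?powRr1// gt_eqF.
    by apply: ge0_ler_powR; rewrite ?nnegrE ?powR_ge0// invr_ge0 ltW.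
  case: (e x) e0 eL => [z| |]// z0; rewrite lee_fin => zL.
  rewrite poweR_EFin -EFinM lee_fin -ler_pdivlMr//.
  have -> : L / u x = ((L / u x) `^ s^-1) `^ s by rewrite -powRrM mulVf ?powRr1// gt_eqF.
  by apply: ge0_ler_powR; rewrite ?nnegrE ?powR_ge0 ?(ltW s0).
rewrite (eq_integral (fun x => limn (g ^~ x))); last by move=> x _; exact: limE.
rewrite monotone_convergence//.
apply: lime_le; last by apply: nearW => M; exact: bound.
apply: ereal_nondecreasing_is_cvgn => M N MN; apply: ge0_le_integral => //.
by move=> x _; exact: ndg.
Qed.

End monotone_limit.

Section global.
Context {R : realType} {n : nat}.
Local Notation V := (Rn R n).
Local Notation mu := (@lebesgueRn R n).
Local Notation index := (@dyadic_index n).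
Local Notation Q := (@dyadic_cube R n).

Definition square_sum (f : V -> R) (x : V) : \bar R :=
  \esum_(q in [set: index])
    ((average (Q q) f - average (Q (dyadic_parent q)) f) ^+ 2 * \1_(Q q) x)%:E.

Lemma square_sum_levels (f : V -> R) (x : V) :
  square_sum f x = \esum_(k in [set: int]) (jump f (dyadic_cell k x))%:E.
Proof.
pose D : set index := range (fun k => dyadic_cell k x).
transitivity (\esum_(q in D) (jump f q)%:E)%E.
  rewrite esum_mkcond; apply: eq_esum => q _; rewrite indicE.
  have [/set_mem[k _ <-]|qD] := boolP (q \in D).
    by rewrite mem_set ?mulr1//; exact: mem_dyadic_cell.
  rewrite memNset ?mulr0// => /dyadic_cubeE qx; move/negP: qD; apply.
  by rewrite inE; exists q.1.
rewrite (reindex_esum [set: int] _ (fun k => dyadic_cell k x))//.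
split=> [k _|k l _ _|q [k _ <-]]; first by exists k.
  by move=> /(congr1 fst).
by exists k.
Qed.

Definition symmetric_square (M : nat) (f : V -> R) (x : V) : R :=
  truncated_square M.*2 f M%:Z x.

(** Level M at the top and 2 M generations: the levels M - 1, ..., 0 and
    -1, ..., -M. *)
Lemma symmetric_squareE M f x : symmetric_square M f x =
  \sum_(0 <= i < M) (jump f (dyadic_cell i%:Z x) + jump f (dyadic_cell (Negz i) x)).
Proof.
rewrite /symmetric_square /truncated_square -addnn big_split_ord big_split/=.
congr (_ + _); rewrite big_mkord.
  rewrite (reindex_inj rev_ord_inj)/=; apply: eq_bigr => i _.
  by congr (jump f (dyadic_cell _ x)); have := ltn_ord i; lia.
apply: eq_bigr => i _; congr (jump f (dyadic_cell _ x)); rewrite NegzE; lia.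
Qed.

(** One cube of each level contains x, so the sum over all cubes is a sum over the
    integers, whose two halves are series over the naturals. *)
Lemma square_sum_sup f x :
  square_sum f x = ereal_sup (range (fun M => (symmetric_square M f x)%:E)).
Proof.
rewrite square_sum_levels.
pose a k := (jump f (dyadic_cell k x))%:E.
have a0 k : (0 <= a k)%E by rewrite lee_fin sqr_ge0.
rewrite (esumID (range Posz))//; last by move=> k _; exact: a0.
rewrite !setTI (_ : ~` range Posz = range Negz); last first.
  apply/seteqP; split => [[k|k] /= h|_ [k _ <-] [l _]]//.
    by exfalso; apply: h; exists k.
  by exists k.
rewrite (reindex_esum [set: nat] (range Posz) Posz); last first.
  by split=> [k _|k l _ _ []|_ [k _ <-]]//; exists k.
rewrite (reindex_esum [set: nat] (range Negz) Negz); last first.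
  by split=> [k _|k l _ _ []|_ [k _ <-]]//; exists k.
rewrite -!nneseries_esumT; [|by move=> k; exact: a0..].
rewrite -nneseriesD; [|by move=> k _ _; exact: a0..].
apply/cvg_lim => //.
rewrite (_ : (fun M => _) = fun M => (symmetric_square M f x)%:E).
  apply: ereal_nondecreasing_cvgn => M N MN; rewrite lee_fin !symmetric_squareE.
  rewrite [leRHS](big_cat_nat _ MN)//= lerDl; apply: sumr_ge0 => i _.
  by rewrite addr_ge0// sqr_ge0.
apply/funext => M; rewrite symmetric_squareE -sumEFin; apply: eq_bigr => i _.
by rewrite EFinD.
Qed.

Section weights.
Context (p : R) (hp : 1 < p) (u v : V -> R) (hu : weight u) (hv : weight v).

Let p0 : 0 < p. Proof. exact: lt_trans hp. Qed.
Let u0 x : 0 <= u x. Proof. exact: hu.1. Qed.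
Let v0 x : 0 <= v x. Proof. exact: hv.1. Qed.
Let mw : measurable_fun [set: V] u. Proof. exact: hu.2.1. Qed.
Let mv : measurable_fun [set: V] v. Proof. exact: hv.2.1. Qed.

Lemma weighted_norm_square f : weighted_norm p u (square_function f) =
  poweR (\int[mu]_x (poweR (square_sum f x) (p / 2) * (u x)%:E))%E p^-1.
Proof.
congr (poweR _ _); apply: eq_integral => x _.
rewrite gee0_abs ?poweR_ge0// /square_function -poweRrM mulrC.
by rewrite -/(square_sum f x).
Qed.

Lemma weighted_norm_real f : weighted_norm p v (EFin \o f) =
  poweR (\int[mu]_x (`|f x| `^ p * v x)%:E)%E p^-1.
Proof. by congr (poweR _ _); apply: eq_integral => x _; rewrite /= EFinM. Qed.

(** The cubes of level k are disjoint and fill the space, so the estimates on them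
    add up; then k goes to infinity. *)
Lemma local_to_global (C : R) f : 0 <= C -> dyadic_integrable f ->
  (forall N q,
   (\int[mu]_(x in Q q) (truncated_square N f q.1 x `^ (p / 2) * u x)%:E <=
    C%:E * \int[mu]_(x in Q q) (`|f x| `^ p * v x)%:E)%E) ->
  (weighted_norm p u (square_function f) <=
   (C `^ p^-1)%:E * weighted_norm p v (EFin \o f))%E.
Proof.
move=> C0 lf loc; rewrite weighted_norm_square weighted_norm_real.
set Y := (X in (_ * poweR X _)%E).
have mfv : measurable_fun [set: V] (fun x => `|f x| `^ p * v x).
  by apply: (measurable_funM _ mv); exact: measurable_powR_fun (dyadic_integrable_normr lf).1.
have fv0 x : 0 <= `|f x| `^ p * v x by rewrite mulr_ge0 ?powR_ge0.
have Y0 : (0 <= Y)%E by exact: integral_real_ge0.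
have mS N k : measurable_fun [set: V] (fun x => truncated_square N f k x `^ (p / 2) * u x).
  apply: (measurable_funM _ mw); apply: measurable_powR_fun.
  exact: measurable_truncated_square.
have S0 N k x : 0 <= truncated_square N f k x `^ (p / 2) * u x.
  by rewrite mulr_ge0 ?powR_ge0.
have level N k :
    (\int[mu]_x (truncated_square N f k x `^ (p / 2) * u x)%:E <= C%:E * Y)%E.
  rewrite /Y (ge0_integral_level k (measurable_EFin_fun (mS N k))); last first.
    by move=> x; rewrite lee_fin.
  rewrite (ge0_integral_level k (measurable_EFin_fun mfv)); last first.
    by move=> x; rewrite lee_fin.
  rewrite -nneseriesZl; last by move=> i _; exact: integral_real_ge0.
  apply: lee_nneseries => [i _|i _]; first by move=> _; exact: integral_real_ge0.
  rewrite /level_cube; case: pickle_inv => [q|]; first exact: (loc N (k, q)).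
  by rewrite !integral_set0 mule0.
have main : (\int[mu]_x (poweR (square_sum f x) (p / 2) * (u x)%:E) <= C%:E * Y)%E.
  apply: (@integral_poweR_sup_le _ _ _ _ (fun M => symmetric_square M f)) => //.
  - by rewrite divr_gt0.
  - by move=> M; exact: measurable_truncated_square.
  - by move=> M x; exact: truncated_square_ge0.
  - move=> x M N MN; rewrite !symmetric_squareE.
    rewrite [leRHS](big_cat_nat _ MN)//= lerDl; apply: sumr_ge0 => i _.
    by rewrite addr_ge0// sqr_ge0.
  - by move=> x; exact: square_sum_sup.
  - by move=> M; exact: level.
rewrite -poweR_EFin -poweRM//.
apply: gt0_ler_poweR => //; first by rewrite invr_ge0 ltW.
  rewrite in_itv/= leey andbT; apply: integral_ge0 => x _.
  by rewrite mule_ge0 ?poweR_ge0// lee_fin.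
by rewrite in_itv/= leey andbT mule_ge0// lee_fin.
Qed.

End weights.
End global.

Theorem theorem1p10 (R : realType) (n : nat) (p : R) (u v : Rn R n -> R)
    (hp : 1 < p) (hu : weight u) (hv : weight v) :
  (p <= 2 ->
    forall B : R -> R, young_function B -> Bcond p (young_associate B) ->
    (ereal_sup [set normQ p Q (epow u p^-1) * luxemburg B Q (epow v (- p^-1))
               | Q in cubes R n] < +oo)%E ->
    exists2 C : R, 0 < C & forall f : Rn R n -> R, locally_integrable_Rn f ->
      (weighted_norm p u (square_function f)
         <= C%:E * weighted_norm p v (EFin \o f))%E)
  /\
  (2 < p ->
    forall A B : R -> R, young_function A -> young_function B ->
    Bcond (conj_exponent (p / 2)) (young_associate A) ->
    Bcond p (young_associate B) ->
    (ereal_sup [set poweR (luxemburg A Q (epow u (2 / p))) 2^-1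
                    * luxemburg B Q (epow v (- p^-1))
               | Q in cubes R n] < +oo)%E ->
    exists2 C : R, 0 < C & forall f : Rn R n -> R, locally_integrable_Rn f ->
      (weighted_norm p u (square_function f)
         <= C%:E * weighted_norm p v (EFin \o f))%E).
Proof.
split=> [p2 B hB BB supB|p2 A B hA hB BA BB supAB].
- have [C C0 loc] := local_estimate_le2 hp hu hv p2 hB BB supB.
  exists (C `^ p^-1); first exact: powR_gt0.
  move=> f /locally_integrable_dyadic lf.
  exact: (local_to_global hp hu hv (ltW C0) lf (loc f lf)).
- have [C C0 loc] := local_estimate_gt2 hp hu hv p2 hA hB BA BB supAB.
  exists (C `^ p^-1); first exact: powR_gt0.
  move=> f /locally_integrable_dyadic lf.
  exact: (local_to_global hp hu hv (ltW C0) lf (loc f lf)).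
Qed.
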